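(* Let $1<p<\infty$ and $0<\alpha<\infty$. Then the Cesàro operator $\mathsf{C}$ fails to be compact on $A^p_{\alpha+}$ and fails to be compact on $A^p_{\alpha-}$.
   Context: $\mathbb{D}=\{z\in\mathbb{C}:|z|<1\}$, $H(\mathbb{D})$ is the space of all analytic functions on $\mathbb{D}$, and $\mathbb{N}=\{1,2,\dots\}$. For $1<p<\infty$ and $0<\mu<\infty$, the weighted Bergman space $A^p_\mu$ is the Banach space of all $f\in H(\mathbb{D})$ with $\|f\|_{p,\mu}:=\left(\int_{\mathbb{D}}|f(z)|^p(1-|z|)^\mu\,ds(z)\right)^{1/p}<\infty$, where $ds(z)=\frac1\pi\,dx\,dy$. For $0<\alpha<\infty$, $A^p_{\alpha+}:=\bigcap_{\mu>\alpha}A^p_\mu=\bigcap_{n\in\mathbb{N}}A^p_{\alpha+1/n}$, a Fréchet space with the topology generated by the increasing sequence of norms $\|\cdot\|_{p,\alpha+1/n}$, $n\in\mathbb{N}$. For $0<\alpha<\infty$, $A^p_{\alpha-}:=\bigcup_{0<\mu<\alpha}A^p_\mu=\bigcup_{n\in\mathbb{N},\,n>1/\alpha}A^p_{\alpha-1/n}$, with the finest locally convex topology for which all inclusions $A^p_\mu\hookrightarrow A^p_{\alpha-}$, $0<\mu<\alpha$, are continuous (i.e. the (LB)-space that is the inductive limit of the Banach spaces $A^p_{\alpha-1/n}$). The Cesàro operator is $\mathsf{C}(f)(z)=\frac1z\int_0^z\frac{f(\zeta)}{1-\zeta}\,d\zeta$ for $z\in\mathbb{D}\setminus\{0\}$,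 $\mathsf{C}(f)(0)=f(0)$, for $f\in H(\mathbb{D})$. It restricts to continuous linear operators on $A^p_{\alpha+}$ and on $A^p_{\alpha-}$. A linear operator $T:X\to X$ on a Hausdorff locally convex space is compact if it maps some neighbourhood of $0$ onto a relatively compact subset of $X$. *)

(* Defs.v *)
From HB Require Import structures.
From mathcomp Require Import all_boot all_order all_algebra.
From mathcomp Require Import finmap complex.
From mathcomp Require Import all_classical all_reals all_analysis.
From mathcomp Require Import measurable_realfun.

Set Implicit Arguments.
Unset Strict Implicit.
Unset Printing Implicit Defensive.

Import Order.TTheory GRing.Theory Num.Theory.
Import ComplexField.Normc.
Import numFieldNormedType.Exports.

Local Open Scope classical_set_scope.
Local Open Scope ring_scope.
Local Open Scope complex_scope.

Definition locally_convex_topology (K : numFieldType) (V : lmodType K)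
    (tau : Topological V) : Prop :=
  let X := Topological.Pack tau in
  [/\ continuous (fun x : X * X => (x.1 : V) + x.2 : X),
      continuous (fun x : K^o * X => x.1 *: (x.2 : V) : X) &
      exists2 B : set (set X),
        (forall b : set (convex_lmodType V), b \in B -> convex_set b) & basis B].

(* The finest locally convex topology on V making every u j continuous.       *)
(* The subbase below is the union of all locally convex topologies with this  *)
(* property, so the generated topology is their supremum.  That it has the    *)
(* property itself is [final_lc_admissible]; that it is the finest one is     *)
(* [final_lc_open].                                                           *)
Definition final_lc_topology (K : numFieldType) (V : lmodType K) (J : Type)
  (E : J -> topologicalType) (u : forall j, E j -> V) : Type := V.

Section final_lc.
Variables (K : numFieldType) (V : lmodType K) (J : Type).
Variables (E : J -> topologicalType) (u : forall j, E j -> V).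
Local Notation F := (final_lc_topology u).

Definition final_admissible (tau : Topological V) : Prop :=
  locally_convex_topology tau /\
  forall j, continuous (@u j : E j -> Topological.Pack tau).

Definition final_lc_subbase : set (set V) :=
  [set U : set V | exists2 tau, final_admissible tau &
                                @open (Topological.Pack tau) U].

HB.instance Definition _ := GRing.Lmodule.on F.
HB.instance Definition _ := isSubBaseTopological.Build F final_lc_subbase id.

Lemma final_lc_open tau (U : set V) : final_admissible tau ->
  @open (Topological.Pack tau) U -> @open F U.
Proof.
move=> htau oU; exists [set U]; last by rewrite bigcup_set1.
move=> _ ->; exists [fset U]%fset.
  by move=> ?; rewrite inE inE => /eqP->; exists tau.
by rewrite set_fset1 bigcap_set1.
Qed.

Lemma final_lc_cvg (G : set_system V) (x : V) : Filter G ->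
  (forall tau, final_admissible tau -> G --> (x : Topological.Pack tau)) ->
  G --> (x : F).
Proof.
move=> GF Gx A; rewrite (@nbhsE F) => -[_ [[B sB <-] [C BC Cx]] sBA].
rewrite nbhs_filterE; apply: filterS sBA _; apply: (@filterS _ _ _ C).
  by move=> y Cy; exists C.
have /sB [D sD IDeC] := BC; rewrite -IDeC; apply: filter_bigI => U DU.
have /sD := DU; rewrite inE => -[tau htau oU].
apply: (Gx _ htau); apply: (@open_nbhs_nbhs (Topological.Pack tau)); split => //.
by move: Cx; rewrite -IDeC; exact.
Qed.

Lemma final_lc_nbhs tau (x : V) (U : set V) : final_admissible tau ->
  nbhs (x : Topological.Pack tau) U -> nbhs (x : F) U.
Proof.
move=> htau; rewrite (@nbhsE (Topological.Pack tau)) => -[B [oB Bx] BU].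
rewrite (@nbhsE F); exists B => //; split=> //; exact: final_lc_open htau oB.
Qed.

Lemma final_lc_add : continuous (fun x : F * F => x.1 + x.2).
Proof.
move=> x; apply: final_lc_cvg => tau htau U /= nU.
have [[addc _ _] _] := htau.
have [[A B] /= [nA nB] AB] := addc x U nU.
by exists (A, B) => //; split; exact: (final_lc_nbhs htau).
Qed.

Lemma final_lc_scale : continuous (fun x : K^o * F => x.1 *: x.2).
Proof.
move=> x; apply: final_lc_cvg => tau htau U /= nU.
have [[_ scalec _] _] := htau.
have [[A B] /= [nA nB] AB] := scalec x U nU.
by exists (A, B) => //; split => //; exact: (final_lc_nbhs htau).
Qed.

Lemma final_lc_convex : exists2 B : set_system F,
  (forall b, b \in B -> convex_set b) & basis B.
Proof.
exists [set b : set F | open b /\ convex_set (b : set (convex_lmodType V))].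
  by move=> b /set_mem[].
split; first by move=> b [].
move=> x U Ux.
pose P := [set b : set F |
  [/\ open b, convex_set (b : set (convex_lmodType V)) & b x]].
have PF : Filter (filter_from P id).
  apply: filter_from_filter.
    by exists setT; split => [|? ? ? _ _|]; [exact: openT|exact: mem_set|].
  move=> b c [ob cb bx] [oc cc cx]; exists (b `&` c) => //; split=> //.
    exact: openI.
  move=> y z l /set_mem[yb yc] /set_mem[zb zc]; apply: mem_set; split; apply: set_mem.
    by apply: cb; exact: mem_set.
  by apply: cc; exact: mem_set.
have /(_ U Ux) [b [ob cb bx] bU] : filter_from P id --> (x : F); last by exists b.
apply: final_lc_cvg => tau htau W Wx.
have [[_ _ [B cB bB]] _] := htau.
have [b /= [Bb bx] bW] := bB.2 x W Wx.
exists b => //; split => //.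
  by apply: (final_lc_open htau); exact: bB.1.
by apply: cB; exact: mem_set.
Qed.

HB.instance Definition _ :=
  PreTopologicalLmod_isTvs.Build K F final_lc_add final_lc_scale final_lc_convex.
HB.instance Definition _ :=
  PreTopologicalNmodule_isTopologicalNmodule.Build F final_lc_add.
HB.instance Definition _ :=
  TopologicalNmodule_isTopologicalLmodule.Build K F final_lc_scale.
HB.instance Definition _ := Uniform_isTvs.Build K F final_lc_convex.

Lemma final_lc_admissible : final_admissible (Topological.on F).
Proof.
split; first by split; [exact: final_lc_add|exact: final_lc_scale|
                        exact: final_lc_convex].
move=> j x; apply: final_lc_cvg => tau [_ utau]; exact: utau.
Qed.

End final_lc.

Section seminorms.
Variables (R : realType) (V : lmodType R[i]) (I : Type) (N : I -> V -> R).

Definition norm_balls : set (set V) :=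
  [set B | exists i f e, 0 < e /\ B = [set g | N i (g - f) < e]].

Definition is_seminorm (q : V -> R) :=
  (forall f g, q (f + g) <= q f + q g) /\ (forall a f, q (a *: f) = normc a * q f).

End seminorms.

Definition seminorm_topology (R : realType) (V : lmodType R[i]) (I : Type)
  (N : I -> V -> R) (sN : forall i, is_seminorm (N i)) : Type := V.

Section seminorm_topology.
Variables (R : realType) (V : lmodType R[i]) (I : Type) (N : I -> V -> R).
Variable (sN : forall i, is_seminorm (N i)).
Local Notation F := (seminorm_topology sN).
Let C := (R[i]^o).

HB.instance Definition _ := GRing.Lmodule.on F.
HB.instance Definition _ := isSubBaseTopological.Build F (norm_balls N) id.

Let ND i f g : N i (f + g) <= N i f + N i g. Proof. exact: (sN i).1. Qed.
Let NZ i a f : N i (a *: f) = normc a * N i f. Proof. exact: (sN i).2. Qed.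
Let N0 i : N i 0 = 0. Proof. by rewrite -(scale0r 0) NZ normc0 mul0r. Qed.
Let NN i f : N i (- f) = N i f.
Proof. by rewrite -scaleN1r NZ normcN normc1 mul1r. Qed.
Let N_ge0 i f : 0 <= N i f.
Proof.
have := ND i f (- f).
by rewrite subrr N0 NN -mulr2n pmulrn_lge0.
Qed.

Lemma seminorm_open i (f : V) e : 0 < e -> @open F [set g | N i (g - f) < e].
Proof.
move=> e0; set U := [set g | _]; exists [set U]; last by rewrite bigcup_set1.
move=> _ ->; exists [fset U]%fset.
  by move=> ?; rewrite inE inE => /eqP->; exists i, f, e.
by rewrite set_fset1 bigcap_set1.
Qed.

Lemma seminorm_nbhs i (f : V) e : 0 < e ->
  nbhs (f : F) [set g | N i (g - f) < e].
Proof.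
move=> e0; apply: (@open_nbhs_nbhs F); split; first exact: seminorm_open.
by rewrite /= subrr N0.
Qed.

Lemma seminorm_cvg (G : set_system V) (x : V) : Filter G ->
  (forall i e, 0 < e -> G [set g | N i (g - x) < e]) -> G --> (x : F).
Proof.
move=> GF Gx A; rewrite (@nbhsE F) => -[_ [[B sB <-] [D BD Dx]] sBA].
rewrite nbhs_filterE; apply: filterS sBA _; apply: (@filterS _ _ _ D).
  by move=> y Dy; exists D.
have /sB [D' sD IDeC] := BD; rewrite -IDeC; apply: filter_bigI => U DU.
have /sD := DU; rewrite inE => -[i [f [e [e0 UE]]]].
have : U x by move: Dx; rewrite -IDeC; exact.
rewrite {}UE /= => xe.
have := Gx i (e - N i (x - f)); rewrite subr_gt0 => /(_ xe).
apply: filterS => g /=; rewrite ltrBrDr; apply: le_lt_trans.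
by have := ND i (g - x) (x - f); rewrite addrA subrK.
Qed.

Lemma seminorm_add : continuous (fun x : F * F => x.1 + x.2).
Proof.
move=> x; apply: seminorm_cvg => i e e0 /=.
exists ([set g | N i (g - x.1) < e / 2], [set g | N i (g - x.2) < e / 2]).
  by split; apply: seminorm_nbhs; rewrite divr_gt0.
move=> [a b] /= [ax bx]; rewrite (splitr e).
rewrite opprD addrACA; apply: le_lt_trans (ND _ _ _) _; exact: ltrD.
Qed.

Lemma seminorm_scale : continuous (fun x : (R[i])^o * F => x.1 *: x.2).
Proof.
move=> [a x]; apply: seminorm_cvg => i e e0 /=.
pose M := N i x + 1; pose A := normc a + 1.
have n0 (z : R[i]) : 0 <= normc z by case: z => ? ?; exact: sqrtr_ge0.
have M0 : 0 < M by rewrite ltr_wpDl.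
have A0 : 0 < A by rewrite ltr_wpDl// n0.
pose r := Num.min 1 (e / 2 / M).
have r0 : 0 < r by rewrite lt_min ltr01/= !divr_gt0.
exists (ball (a : (R[i])^o) r%:C, [set g | N i (g - x) < e / 2 / A]).
  split; first by apply: nbhsx_ballx; rewrite ltcR.
  by apply: seminorm_nbhs; rewrite !divr_gt0.
move=> [b y] /= [+ yx]; rewrite -ball_normE /= => abr.
have {}abr : normc (b - a) < r.
  by move: abr; rewrite -normrN opprB -ltcR.
have -> : b *: y - a *: x = b *: (y - x) + (b - a) *: x.
  by rewrite scalerBr scalerBl addrA subrK.
apply: le_lt_trans (ND _ _ _) _; rewrite !NZ (splitr e).
apply: ltr_leD.
  apply: le_lt_trans (_ : A * N i (y - x) < _); last first.
    by rewrite mulrC -ltr_pdivlMr.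
  rewrite ler_wpM2r// /A -[b in leLHS](subrK a) addrC.
  apply: le_trans (le_normcD _ _) _; rewrite lerD2l (le_trans (ltW abr))//.
  by rewrite ge_min lexx.
apply: (@le_trans _ _ (r * M)).
  by rewrite ler_pM ?n0 ?(ltW abr)// lerDl.
by rewrite -ler_pdivlMr// ge_min lexx orbT.
Qed.

Lemma seminorm_ball_convex i (x y z : V) (e : R) (t : R[i]) :
  0 < t -> t < 1 -> N i (y - x) < e -> N i (z - x) < e ->
  N i (t *: y + (1 - t) *: z - x) < e.
Proof.
case: t => a b; rewrite !ltcE /= => /andP[/eqP -> a0] /andP[_ a1] ye ze.
have {1}-> : x = (a +i* 0) *: x + (1 - (a +i* 0)) *: x.
  by rewrite -scalerDl addrC subrK scale1r.
rewrite opprD addrACA -!scalerBr; apply: le_lt_trans (ND _ _ _) _; rewrite !NZ /=.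
rewrite subr0 expr0n/= !addr0 !sqrtr_sqr !gtr0_norm ?subr_gt0//.
apply: (@lt_le_trans _ _ (a * e + (1 - a) * e)).
  by rewrite ltrD// ltr_pM2l// subr_gt0.
by rewrite -mulrDl addrC subrK mul1r.
Qed.

Lemma seminorm_convex : exists2 B : set_system F,
  (forall b, b \in B -> convex_set b) & basis B.
Proof.
exists [set b : set F | open b /\ convex_set (b : set (convex_lmodType V))].
  by move=> b /set_mem[].
split; first by move=> b [].
move=> x U Ux.
pose P := [set b : set F |
  [/\ open b, convex_set (b : set (convex_lmodType V)) & b x]].
have PF : Filter (filter_from P id).
  apply: filter_from_filter.
    by exists setT; split => [|? ? ? _ _|]; [exact: openT|exact: mem_set|].
  move=> b c [ob cb bx] [oc cc cx]; exists (b `&` c) => //; split=> //.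
    exact: openI.
  move=> y z l /set_mem[yb yc] /set_mem[zb zc]; apply: mem_set; split; apply: set_mem.
    by apply: cb; exact: mem_set.
  by apply: cc; exact: mem_set.
have /(_ U Ux) [b [ob cb bx] bU] : filter_from P id --> (x : F); last by exists b.
apply: seminorm_cvg => i e e0.
exists [set g | N i (g - x) < e] => //; split; first exact: seminorm_open.
  apply/convex_setW => y z /set_mem/= ye /set_mem/= ze l l0 l1; apply: mem_set => /=.
  exact: seminorm_ball_convex.
by rewrite /= subrr N0.
Qed.

HB.instance Definition _ :=
  PreTopologicalLmod_isTvs.Build (R[i]) F seminorm_add seminorm_scale seminorm_convex.
HB.instance Definition _ :=
  PreTopologicalNmodule_isTopologicalNmodule.Build F seminorm_add.
HB.instance Definition _ :=
  TopologicalNmodule_isTopologicalLmodule.Build (R[i]) F seminorm_scale.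
HB.instance Definition _ := Uniform_isTvs.Build (R[i]) F seminorm_convex.

End seminorm_topology.

Section definitions.
Variable R : realType.
Local Notation C := (R[i]^o).
Implicit Types (f : C -> C) (p mu alpha : R).

Definition disc : set C := [set z | normc z < 1].

Definition holomorphic f := forall z, disc z -> derivable f z 1.

(* ds = pi^-1 dx dy on the disc, the plane being coordinatised by R * R. *)
Definition bergman_integral p mu f : \bar R :=
  ((pi^-1)%:E *
  \int[(lebesgue_measure \x lebesgue_measure)]_(w in
      [set w : R * R | disc (w.1 +i* w.2)])
    (normc (f (w.1 +i* w.2)) `^ p * (1 - normc (w.1 +i* w.2)) `^ mu)%:E)%E.

Definition bergman_norm p mu f : R := fine (bergman_integral p mu f) `^ p^-1.

(* A function on the disc is represented by its extension by 0 to C. *)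
Definition bergman_set p mu : set (C -> C) :=
  [set f | [/\ holomorphic f, (forall z, ~ disc z -> f z = 0) &
               (bergman_integral p mu f < +oo)%E]].

Definition bergman_plus_set p alpha : set (C -> C) :=
  [set f | forall mu, alpha < mu -> bergman_set p mu f].

Definition bergman_minus_set p alpha : set (C -> C) :=
  [set f | exists2 mu, 0 < mu < alpha & bergman_set p mu f].

(* The integral of f dzeta along the segment [0, z]. *)
Definition segment_integral f (z : C) : C :=
  z * ((\int[lebesgue_measure]_(t in `[0, 1]) complex.Re (f (t%:C * z)))%R +i*
       (\int[lebesgue_measure]_(t in `[0, 1]) complex.Im (f (t%:C * z)))%R).

Definition cesaro_op f : C -> C := fun z =>
  if ~~ (normc z < 1) then 0
  else if z == 0 then f 0
  else z^-1 * segment_integral (fun zeta => f zeta / (1 - zeta)) z.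

End definitions.

Section subspaces.
Variable R : realType.
Local Notation C := (R[i]^o).
Implicit Types (f g : C -> C) (p mu alpha : R).

Lemma normCE (z : C) : `|z| = (normc z)%:C.
Proof. by []. Qed.

Lemma normc_continuous : continuous (fun z : C => normc z : R^o).
Proof.
move=> z; apply/(@cvgrPdist_lt R R^o C (nbhs z)) => e e0.
have ec : 0 < e%:C by rewrite ltcR.
have : nbhs z (ball z (e%:C)) by exact: (@nbhsx_ballx _ C z _ ec).
apply: filterS => w; rewrite -ball_normE /=.
rewrite normCE ltcR; apply: le_lt_trans.
rewrite ler_norml; apply/andP; split.
  rewrite -lerN2 opprK opprB.
  rewrite lerBlDr -(opprB w z) normcN.
  by have := le_normcD (w - z : C) z; rewrite subrK.
rewrite lerBlDr.
by have := le_normcD (z - w : C) w; rewrite subrK.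
Qed.

Lemma real_complex_continuous : continuous (fun x : R^o => x%:C : C).
Proof.
move=> x; apply/(@cvgrPdist_lt R[i] C R^o (nbhs x)) => -[e e']; rewrite ltcE /= => /andP[/eqP -> e0].
have : nbhs x (ball x e) by exact: (@nbhsx_ballx _ R^o).
apply: filterS => y; rewrite -ball_normE /= => xye.
rewrite -rmorphB normCE /= expr0n addr0 sqrtr_sqr.
by rewrite -[e +i* 0]/(e%:C) ltcR.
Qed.

Lemma plane_continuous : continuous (fun w : R^o * R^o => w.1 +i* w.2 : C).
Proof.
move=> w.
rewrite (_ : (fun w : R^o * R^o => w.1 +i* w.2 : C) =
  (fun w => w.1%:C + ('i : C) *: (w.2%:C : C))); last first.
  apply/funext => -[x y] /=; apply/eqP; rewrite eq_complex /=.
  by rewrite !(mul0r, mul1r, subr0, addr0, add0r) !eqxx.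
apply: cvgD.
  by apply: continuous_comp; [exact: cvg_fst|exact: real_complex_continuous].
apply: cvgZr.
by apply: continuous_comp; [exact: cvg_snd|exact: real_complex_continuous].
Qed.

Definition disc_plane := [set w : R * R | disc (w.1 +i* w.2)].

Lemma open_plane_measurable (U : set (R^o * R^o)) : open U ->
  measurable (U : set (measurableTypeR R * measurableTypeR R)).
Proof.
move=> oU.
pose B (q : (rat * rat) * (rat * rat)) : set (R * R) :=
  ball (ratr q.1.1 : R^o) (ratr q.1.2) `*` ball (ratr q.2.1 : R^o) (ratr q.2.2).
rewrite (_ : U = \bigcup_q (if `[< B q `<=` U >] then B q else set0)); last first.
  apply/seteqP; split => [[x y] Uxy|w [q _]]; last by case: asboolP => // + Bw; exact.
  have [[V W] /= [Vx Wy] VWU] := oU _ Uxy.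
  rewrite nbhsE in Vx; rewrite nbhsE in Wy.
  case: Vx => V' [oV V'x] V'V; case: Wy => W' [oW W'y] W'W.
  have [c1 [r1 /= []]] := open_subball_rat oV (mem_set V'x).
  rewrite inE => xB BV.
  have [c2 [r2 /= []]] := open_subball_rat oW (mem_set W'y).
  rewrite inE => yB BW.
  exists ((c1, r1), (c2, r2)) => //=.
  case: asboolP => // -[]; move=> [a b] [/= Ba Bb]; apply: VWU; split => /=.
    by apply: V'V; exact: BV.
  by apply: W'W; exact: BW.
apply: countable_bigcupT_measurable => // q.
case: asboolP => // _; apply: measurableX; apply: open_measurable; exact: ball_open.
Qed.

Lemma open_disc : open (@disc R).
Proof.
have := @open_comp _ _ (fun z : C => normc z : R^o) `]-oo, 1[%classic.
rewrite (_ : _ @^-1` _ = @disc R); last first.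
  by apply/seteqP; split => z; rewrite /= in_itv.
apply => //; move=> z _; exact: normc_continuous.
Qed.

Lemma open_disc_plane : open (disc_plane : set (R^o * R^o)).
Proof.
apply: (@open_comp _ _ (fun w : R^o * R^o => w.1 +i* w.2 : C) (@disc R)).
  by move=> z _; exact: plane_continuous.
exact: open_disc.
Qed.

Lemma measurable_disc_plane :
  measurable (disc_plane : set (measurableTypeR R * measurableTypeR R)).
Proof. by apply: open_plane_measurable; exact: open_disc_plane. Qed.

Lemma holomorphic_continuous f z : holomorphic f -> disc z ->
  {for z, continuous f}.
Proof.
by move=> hf dz; apply: differentiable_continuous; apply/derivable1_diffP/hf.
Qed.

Lemma measurable_plane (g : C -> C) : (forall z, disc z -> {for z, continuous g}) ->
  measurable_fun (disc_plane : set (measurableTypeR R * measurableTypeR R))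
    (fun w => normc (g (w.1 +i* w.2))).
Proof.
move=> gc; apply: (measurability _ (RGenOInfty.measurableE R)).
move=> /= _ [_ [x ->] <-].
apply: (@open_plane_measurable (disc_plane `&`
   (fun w : R^o * R^o => normc (g (w.1 +i* w.2))) @^-1` `]x, +oo[)).
rewrite openE => w [dw]; rewrite /= in_itv/= andbT => xw.
rewrite /interior; apply: filterI; first exact: open_disc_plane.
have cw : {for w, continuous (fun w : R^o * R^o => normc (g (w.1 +i* w.2)) : R^o)}.
  apply: (@continuous_comp _ _ _ (fun w : R^o * R^o => w.1 +i* w.2 : C)
    (fun z : C => normc (g z) : R^o)); first exact: plane_continuous.
  apply: (@continuous_comp _ _ _ g (fun z : C => normc z : R^o)); first exact: gc.
  exact: normc_continuous.
apply: cw.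
have := @open_nbhs_nbhs R^o (normc (g (w.1 +i* w.2))) `]x, +oo[%classic.
by apply; split => //=; rewrite in_itv/= andbT.
Qed.


Lemma bergman_integrand_measurable p mu f : holomorphic f ->
  measurable_fun (disc_plane : set (measurableTypeR R * measurableTypeR R))
    (fun w => (normc (f (w.1 +i* w.2)) `^ p *
               (1 - normc (w.1 +i* w.2)) `^ mu)%:E).
Proof.
move=> hf; apply/measurable_EFinP; apply: measurable_funM.
  apply: (measurableT_comp (measurable_powR p)).
  by apply: measurable_plane => z; exact: holomorphic_continuous.
apply: (measurableT_comp (measurable_powR mu)).
apply: measurable_funB => //.
by apply: (@measurable_plane id) => z _; exact: cvg_id.
Qed.

Lemma bergman_integrand_ge0 p mu f (w : R * R) :
  (0 <= (normc (f (w.1 +i* w.2)) `^ p *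
         (1 - normc (w.1 +i* w.2)) `^ mu)%:E)%E.
Proof. by rewrite lee_fin mulr_ge0// powR_ge0. Qed.

Lemma bergman_integral_ltP p mu f : (bergman_integral p mu f < +oo)%E <->
  (\int[(lebesgue_measure \x lebesgue_measure)]_(w in disc_plane)
    (normc (f (w.1 +i* w.2)) `^ p *
     (1 - normc (w.1 +i* w.2)) `^ mu)%:E < +oo)%E.
Proof.
rewrite /bergman_integral -/disc_plane; split => [h|h]; last first.
  rewrite lte_mul_pinfty// ?lee_fin ?invr_ge0 ?pi_ge0//.
rewrite ltey; apply/eqP => hoo; move: h; rewrite hoo.
by rewrite gt0_muley ?ltxx// lte_fin invr_gt0 pi_gt0.
Qed.

Lemma bergman_le p mu nu f : mu <= nu -> bergman_set p mu f ->
  bergman_set p nu f.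
Proof.
move=> munu [hf f0 /bergman_integral_ltP fi]; split => //.
apply/bergman_integral_ltP; apply: le_lt_trans fi.
apply: ge0_le_integral => //.
- exact: measurable_disc_plane.
- by move=> w _; exact: bergman_integrand_ge0.
- exact: bergman_integrand_measurable.
- exact: bergman_integrand_measurable.
move=> w; rewrite /disc_plane /disc /= => wD; rewrite lee_fin ler_wpM2l ?powR_ge0//.
rewrite ger_powR// subr_gt0 wD/= gerBl.
exact: sqrtr_ge0.
Qed.

Lemma bergman_set0 p mu : 0 < p -> bergman_set p mu 0.
Proof.
move=> p0; split => [z _|//|]; first exact: derivable_cst.
apply/bergman_integral_ltP; rewrite integral0_eq// => w _.
by rewrite normc0 powR0 ?gt_eqF// mul0r.
Qed.

Lemma bergman_setD p mu f g : 0 < p -> bergman_set p mu f ->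
  bergman_set p mu g -> bergman_set p mu (f + g).
Proof.
move=> p0 [hf f0 /bergman_integral_ltP fi] [hg g0 /bergman_integral_ltP gi].
have hfg : holomorphic (f + g).
  by move=> z dz; apply: derivableD; [exact: hf|exact: hg].
split => //.
  by move=> z dz; rewrite -[LHS]/(f z + g z) f0// g0// addr0.
have mf := @bergman_integrand_measurable p mu f hf.
have mg := @bergman_integrand_measurable p mu g hg.
have mD := measurable_disc_plane.
have F0 := @bergman_integrand_ge0 p mu.
apply/bergman_integral_ltP.
apply: (@le_lt_trans _ _ (\int[(lebesgue_measure \x lebesgue_measure)]_(w in disc_plane)
    ((2 `^ p)%:E * ((normc (f (w.1 +i* w.2)) `^ p *
                     (1 - normc (w.1 +i* w.2)) `^ mu)%:E +
                    (normc (g (w.1 +i* w.2)) `^ p *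
                     (1 - normc (w.1 +i* w.2)) `^ mu)%:E)))%E); last first.
  rewrite (ge0_integralZl _ mD (emeasurable_funD mf mg)); first last.
  - by rewrite lee_fin powR_ge0.
  - by move=> w _; rewrite adde_ge0.
  rewrite ge0_integralD// lte_mul_pinfty// ?lee_fin ?powR_ge0//.
  exact: (lte_add_pinfty fi gi).
apply: ge0_le_integral => //.
- exact: bergman_integrand_measurable.
- by apply: measurable_funeM; exact: emeasurable_funD.
move=> w _; rewrite -EFinD -EFinM lee_fin -mulrDl mulrA ler_wpM2r ?powR_ge0//.
set a := f _; set b := g _.
have n0 (z : C) : 0 <= normc z by case: z => ? ?; exact: sqrtr_ge0.
have ab : normc (a + b) <= 2 * Num.max (normc a) (normc b).
  apply: le_trans (le_normcD _ _) _.
  by rewrite mulr_natl mulr2n lerD// le_max lexx ?orbT.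
apply: (@le_trans _ _ ((2 * Num.max (normc a) (normc b)) `^ p)).
  by rewrite ge0_ler_powR ?nnegrE ?(ltW p0) ?mulr_ge0 ?le_max ?n0.
rewrite powRM ?le_max ?n0// ler_wpM2l ?powR_ge0//.
by case: (leP (normc a) (normc b)) => _; rewrite ?lerDl ?lerDr ?powR_ge0.
Qed.

Lemma bergman_setZ p mu (a : R[i]) f : bergman_set p mu f ->
  bergman_set p mu (a *: f).
Proof.
move=> [hf f0 /bergman_integral_ltP fi]; split.
- by move=> z dz; apply: derivableZ; exact: hf.
- by move=> z dz; rewrite -[LHS]/(a *: f z) f0// scaler0.
have n0 (z : C) : 0 <= normc z by case: z => ? ?; exact: sqrtr_ge0.
apply/bergman_integral_ltP.
under eq_integral => w _.
  rewrite -[(a *: f) _]/(a * f (w.1 +i* w.2)) normcM powRM// -mulrA EFinM.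
  over.
rewrite ge0_integralZl//.
- by rewrite lte_mul_pinfty// lee_fin powR_ge0.
- exact: measurable_disc_plane.
- exact: bergman_integrand_measurable.
- by move=> w _; exact: bergman_integrand_ge0.
- by rewrite lee_fin powR_ge0.
Qed.

Lemma bergman_closed p mu : 1 < p ->
  GRing.subsemimod_closed [in bergman_set p mu].
Proof.
move=> /(lt_trans ltr01) p0; split; first split.
- by apply: mem_set; exact: bergman_set0.
- move=> f g /set_mem hf /set_mem hg; apply: mem_set.
  exact: bergman_setD.
- move=> a f /set_mem hf; apply: mem_set.
  exact: bergman_setZ.
Qed.

Lemma bergman_plus_closed p alpha : 1 < p ->
  GRing.subsemimod_closed [in bergman_plus_set p alpha].
Proof.
move=> /(lt_trans ltr01) p0; split; first split.
- by apply: mem_set => mu _; exact: bergman_set0.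
- move=> f g /set_mem hf /set_mem hg; apply: mem_set => mu amu.
  by apply: bergman_setD => //; [exact: hf|exact: hg].
- move=> a f /set_mem hf; apply: mem_set => mu amu.
  by apply: bergman_setZ; exact: hf.
Qed.

Lemma bergman_minus_closed p alpha : 1 < p -> 0 < alpha ->
  GRing.subsemimod_closed [in bergman_minus_set p alpha].
Proof.
move=> /(lt_trans ltr01) p0 a0; split; first split.
- apply: mem_set; exists (alpha / 2); last exact: bergman_set0.
  by rewrite divr_gt0//= ltr_pdivrMr// ltr_pMr// ltr1n.
- move=> f g /set_mem[mu /andP[mu0 mua] hf] /set_mem[nu /andP[nu0 nua] hg].
  apply: mem_set; exists (Num.max mu nu); first by rewrite lt_max mu0/= gt_max mua.
  apply: (bergman_setD p0).
    by apply: (bergman_le _ hf); rewrite le_max lexx.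
  by apply: (bergman_le _ hg); rewrite le_max lexx orbT.
- move=> a f /set_mem[mu mua hf]; apply: mem_set.
  by exists mu; [exact: mua|exact: bergman_setZ].
Qed.

End subspaces.

Section minkowski.
Variable R : realType.
Local Notation C := (R[i]^o).
Implicit Types (f g : C -> C) (p mu alpha : R).
Local Notation area := ((@lebesgue_measure R \x @lebesgue_measure R)%E).

Let normc_ge0 (z : C) : 0 <= normc z.
Proof. by case: z => ? ?; exact: sqrtr_ge0. Qed.

Let root p mu f := (fun w : measurableTypeR R * measurableTypeR R =>
  (normc (f (w.1 +i* w.2)) * (1 - normc (w.1 +i* w.2)) `^ (mu / p))) \_ (@disc_plane R).

Let measurable_root p mu f : holomorphic f -> measurable_fun setT (root p mu f).
Proof.
move=> hf; rewrite /root; apply: (measurable_restrictT _ (@measurable_disc_plane R)).1.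
apply: measurable_funM.
  by apply: measurable_plane => z; exact: holomorphic_continuous.
apply: (measurableT_comp (measurable_powR _)).
apply: measurable_funB => //.
by apply: (@measurable_plane _ id) => z _; exact: cvg_id.
Qed.

Let density p mu f (w : R * R) := normc (f (w.1 +i* w.2)) `^ p * (1 - normc (w.1 +i* w.2)) `^ mu.

Let rootE p mu f w : 0 < p -> disc_plane w -> `|root p mu f w| `^ p = density p mu f w.
Proof.
move=> p0 wD; rewrite /root patchE mem_set// ger0_norm.
  rewrite powRM ?powR_ge0// -powRrM.
  by rewrite divfK// gt_eqF.
by rewrite mulr_ge0 ?powR_ge0.
Qed.

Let integral_ge0' p mu f : (0 <= \int[area]_(w in @disc_plane R) (density p mu f w)%:E)%E.
Proof. by apply: integral_ge0 => w _; exact: bergman_integrand_ge0. Qed.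

Lemma bergman_integral_fin p mu f : bergman_set p mu f ->
  bergman_integral p mu f \is a fin_num.
Proof.
move=> [_ _ fi]; rewrite ge0_fin_numE//.
by rewrite mule_ge0 ?integral_ge0' ?lee_fin ?invr_ge0 ?pi_ge0.
Qed.

Let Lnorm_root p mu f : 0 < p ->
  Lnorm area p%:E (EFin \o root p mu f) =
  ((\int[area]_(w in @disc_plane R) (density p mu f w)%:E) `^ p^-1)%E.
Proof.
move=> p0; rewrite unlock; congr (_ `^ _)%E.
rewrite [RHS]integral_mkcond; apply: eq_integral => w _.
rewrite [RHS]patchE /comp abse_EFin poweR_EFin; case: ifPn => wD.
  by rewrite rootE//; exact/set_mem.
by rewrite /root patchE (negbTE wD) normr0 powR0// gt_eqF.
Qed.

Let bergman_norm_root p mu f : 1 < p -> bergman_set p mu f ->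
  (bergman_norm p mu f)%:E = ((pi^-1 `^ p^-1)%:E * Lnorm area p%:E (EFin \o root p mu f))%E.
Proof.
move=> p1 bf; have p0 := lt_trans ltr01 p1; rewrite Lnorm_root//.
rewrite /bergman_norm -!poweR_EFin fineK ?bergman_integral_fin//.
rewrite poweRM// ?lee_fin ?invr_ge0 ?pi_ge0//.
by rewrite integral_ge0'.
Qed.

Lemma bergman_normD p mu f g : 1 < p -> bergman_set p mu f ->
  bergman_set p mu g ->
  bergman_norm p mu (f + g) <= bergman_norm p mu f + bergman_norm p mu g.
Proof.
move=> p1 bf bg; have p0 := lt_trans ltr01 p1.
have bfg := bergman_setD p0 bf bg.
have [hf _ _] := bf; have [hg _ _] := bg; have [hfg _ _] := bfg.
have := bergman_norm_root p1 bfg; have := bergman_norm_root p1 bf.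
have := bergman_norm_root p1 bg.
generalize (bergman_norm p mu (f + g)) (bergman_norm p mu f).
generalize (bergman_norm p mu g) => z y x zE yE xE.
rewrite -lee_fin EFinD xE yE zE -muleDr//; last first.
  by rewrite ge0_adde_def// inE Lnorm_ge0.
rewrite lee_pmul2l// ?lte_fin ?powR_gt0 ?invr_gt0 ?pi_gt0//.
have mf := @measurable_root p mu f hf; have mg := @measurable_root p mu g hg.
apply: le_trans (eminkowski area mf mg _); last by rewrite lee_fin ltW.
rewrite unlock gt0_ler_poweR ?invr_ge0 ?(ltW p0)//.
- by rewrite in_itv/= leey integral_ge0// => w _; exact: poweR_ge0.
- by rewrite in_itv/= leey integral_ge0// => w _; exact: poweR_ge0.
have mpow (h : measurableTypeR R * measurableTypeR R -> R) :
    measurable_fun setT h ->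
    measurable_fun setT (fun w => `|(h w)%:E| `^ p)%E.
  move=> mh; apply/measurable_EFinP; apply: (measurableT_comp (measurable_powR p)).
  exact: measurableT_comp.
apply: ge0_le_integral => //.
- by move=> w _; exact: poweR_ge0.
- by apply: mpow; exact: measurable_root.
- by apply: mpow; exact: measurable_funD.
move=> w _; rewrite /comp !abse_EFin !poweR_EFin lee_fin ge0_ler_powR ?nnegrE ?(ltW p0)//.
rewrite /root /= !patchE; case: ifPn => // wD; last first.
  by rewrite -[point]/(0 : R) addr0.
rewrite -mulrDl !ger0_norm ?mulr_ge0 ?powR_ge0 ?addr_ge0//.
by rewrite ler_wpM2r ?powR_ge0//; exact: le_normcD.
Qed.

Lemma bergman_normZ p mu (a : R[i]) f : 1 < p -> bergman_set p mu f ->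
  bergman_norm p mu (a *: f) = normc a * bergman_norm p mu f.
Proof.
move=> p1 bf; have p0 := lt_trans ltr01 p1; have [hf _ _] := bf.
rewrite /bergman_norm.
have -> : bergman_integral p mu (a *: f) =
    ((normc a `^ p)%:E * bergman_integral p mu f)%E.
  rewrite /bergman_integral.
  under eq_integral => w _.
    rewrite -[(a *: f) _]/(a * f (w.1 +i* w.2)) normcM powRM// -mulrA EFinM.
    over.
  rewrite ge0_integralZl//.
  - by rewrite muleCA.
  - exact: measurable_disc_plane.
  - exact: bergman_integrand_measurable.
  - by move=> w _; exact: bergman_integrand_ge0.
  - by rewrite lee_fin powR_ge0.
rewrite fineM ?bergman_integral_fin//= powRM ?powR_ge0//; last first.
  rewrite fine_ge0// mule_ge0 ?integral_ge0' ?lee_fin ?invr_ge0 ?pi_ge0//.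
by rewrite -powRrM divff ?gt_eqF// powRr1.
Qed.
End minkowski.

Definition compact_operator (K : numFieldType) (V : tvsType K)
    (T : {linear V -> V}) : Prop :=
  exists2 U : set V, nbhs 0 U & precompact (T @` U).

Section bergman_space.
Variables (R : realType) (p : R).
Local Notation C := (R[i]^o).

Record bergman (hp : 1 < p) (mu : R) := Bergman {
  bergman_fun :> C -> C;
  bergmanP : bergman_fun \in bergman_set p mu }.

Variables (hp : 1 < p) (mu : R).
Local Notation A := (bergman hp mu).

HB.instance Definition _ := [isSub for @bergman_fun hp mu].
HB.instance Definition _ := [Choice of A by <:].
HB.instance Definition _ :=
  GRing.SubChoice_isSubLmodule.Build _ _ _ A (bergman_closed mu hp).

Lemma bergman_seminorm (_ : unit) :
  is_seminorm (fun f : A => bergman_norm p mu f).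
Proof.
split => [f g|a f].
  by apply: (bergman_normD hp); exact/set_mem/bergmanP.
by apply: (bergman_normZ _ hp); exact/set_mem/bergmanP.
Qed.

HB.instance Definition _ := Tvs.copy A (seminorm_topology bergman_seminorm).

End bergman_space.

Section bergman_plus_space.
Variables (R : realType) (p : R).
Local Notation C := (R[i]^o).

Record bergman_plus (hp : 1 < p) (alpha : R) := BergmanPlus {
  bergman_plus_fun :> C -> C;
  bergman_plusP : bergman_plus_fun \in bergman_plus_set p alpha }.

Variables (hp : 1 < p) (alpha : R).
Local Notation A := (bergman_plus hp alpha).

HB.instance Definition _ := [isSub for @bergman_plus_fun hp alpha].
HB.instance Definition _ := [Choice of A by <:].
HB.instance Definition _ :=
  GRing.SubChoice_isSubLmodule.Build _ _ _ A (bergman_plus_closed alpha hp).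

Lemma bergman_plus_seminorm (n : nat) :
  is_seminorm (fun f : A => bergman_norm p (alpha + n.+1%:R^-1) f).
Proof.
have memA (f : A) : bergman_set p (alpha + n.+1%:R^-1) f.
  by have /set_mem := bergman_plusP f; apply; rewrite ltrDl invr_gt0 ltr0n.
split => [f g|a f].
  by apply: (bergman_normD hp); exact: memA.
by apply: (bergman_normZ _ hp); exact: memA.
Qed.

HB.instance Definition _ := Tvs.copy A (seminorm_topology bergman_plus_seminorm).

End bergman_plus_space.

Section bergman_minus_space.
Variables (R : realType) (p alpha : R).
Local Notation C := (R[i]^o).

Record bergman_minus (hp : 1 < p) (ha : 0 < alpha) := BergmanMinus {
  bergman_minus_fun :> C -> C;
  bergman_minusP : bergman_minus_fun \in bergman_minus_set p alpha }.

Variables (hp : 1 < p) (ha : 0 < alpha).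
Local Notation A := (bergman_minus hp ha).

HB.instance Definition _ := [isSub for @bergman_minus_fun hp ha].
HB.instance Definition _ := [Choice of A by <:].
HB.instance Definition _ :=
  GRing.SubChoice_isSubLmodule.Build _ _ _ A (bergman_minus_closed hp ha).

Lemma bergman_inclP (m : {mu : R | 0 < mu < alpha}) (f : bergman hp (sval m)) :
  (f : C -> C) \in bergman_minus_set p alpha.
Proof.
by apply: mem_set; exists (sval m); [exact: proj2_sig m|exact/set_mem/bergmanP].
Qed.

Definition bergman_incl (m : {mu : R | 0 < mu < alpha})
    (f : bergman hp (sval m)) : A :=
  BergmanMinus hp ha (bergman_inclP f).

HB.instance Definition _ := Tvs.copy A (final_lc_topology bergman_incl).

End bergman_minus_space.

(* Main.v *)
(* For f with C f = G / z, i.e. f = (1 - z) G', the peaks G = (1 + d - z)^-k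
   (d -> 0, k large) show that C gains no integrability near z = 1: f and C f both have
   size d^-k on a set of diameter d at distance d from the circle.  Normalised
   in A^p_mu, f is sent to a function whose A^p_nu-norm blows up like
   d^((nu - mu) / p) for every nu < mu, and this is already seen by the average
   of |C f| over a square of side d close to 1.
   In A^p_{alpha+}, a neighbourhood of 0 contains a ball for some mu > alpha, so
   its image is unbounded in A^p_nu for alpha < nu < mu.
   In A^p_{alpha-}, a neighbourhood U of 0 contains a ball of A^p_mu for every
   mu < alpha.  Taking nu_n < mu_n < alpha increasing to alpha yields g_n in U
   and scales d_n such that the n-th normalised average of |C g_n| exceeds n;
   the supremum over n of these averages is a continuous seminorm on
   A^p_{alpha-}, because the n-th one is controlled by the norm of A^p_mu as
   soon as nu_n >= mu.  So the image of U is again unbounded. *)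
Require Import Defs.
From HB Require Import structures.
From mathcomp Require Import all_boot all_order all_algebra.
From mathcomp Require Import complex.
From mathcomp Require Import all_classical all_reals all_analysis.
From mathcomp Require Import measurable_realfun ring lra.
Set Implicit Arguments.
Unset Strict Implicit.
Unset Printing Implicit Defensive.
Import Order.TTheory GRing.Theory Num.Theory.
Import ComplexField.Normc.
Import numFieldNormedType.Exports.
Local Open Scope classical_set_scope.
Local Open Scope ring_scope.
Local Open Scope complex_scope.

(** * Integration along a segment of a function with a complex antiderivative *)

Section complex_calculus.
Variable R : realType.
Local Notation C := (R[i]^o).
Implicit Types (F : C -> C) (z a : C) (t : R).

Lemma normc_ge0 z : 0 <= normc z.
Proof. by case: z => ? ?; exact: sqrtr_ge0. Qed.

Lemma normr_Re_le_normc z : `|complex.Re z| <= normc z.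
Proof. by have := normc_ge_Re z; rewrite normCE lecR. Qed.

Lemma normr_Im_le_normc z : `|complex.Im z| <= normc z.
Proof. by case: z => x y /=; rewrite -sqrtr_sqr ler_wsqrtr// lerDr sqr_ge0. Qed.

Lemma normcX z n : normc (z ^+ n) = normc z ^+ n.
Proof. by elim: n => [|n ih]; rewrite ?normc1// !exprS normcM ih. Qed.

Lemma normc_real (x : R) : normc x%:C = `|x|.
Proof. by rewrite /= expr0n addr0 sqrtr_sqr. Qed.

Lemma real_linear_continuous (L : C -> R) : {morph L : z a / z - a} ->
  (forall z, `|L z| <= normc z) -> continuous (L : C -> R^o).
Proof.
move=> LB Lle z; apply/(@cvgrPdist_lt R R^o C (nbhs z)) => e e0.
have : nbhs z (ball z (e%:C : C)) by apply: (@nbhsx_ballx _ C); rewrite ltcR.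
apply: filterS => w; rewrite -ball_normE /= normCE ltcR.
by apply: le_lt_trans; rewrite -LB.
Qed.

Lemma Re_continuous : continuous (@complex.Re R : C -> R^o).
Proof. by apply: real_linear_continuous => [[a b] [c d]//|]; exact: normr_Re_le_normc. Qed.

Lemma Im_continuous : continuous (@complex.Im R : C -> R^o).
Proof. by apply: real_linear_continuous => [[a b] [c d]//|]; exact: normr_Im_le_normc. Qed.

(** The real difference quotient at [h] is [L] of the complex one at [h%:C], so the limit passes
    through the continuous [L]. Applied to real and imaginary parts, this gives access to the real
    fundamental theorem of calculus. *)
Lemma is_derive_real_linear (L : C -> R) F t a : continuous (L : C -> R^o) ->
  {morph L : z w / z - w} -> (forall (x : R) z, L (x%:C * z) = x * L z) ->
  is_derive (t%:C : C) (1 : C) F a ->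
  is_derive (t : R^o) (1 : R^o) (fun s : R^o => L (F s%:C) : R^o) (L a).
Proof.
move=> Lc LB LZ [dF <-].
have real0 : (fun h : R^o => h%:C : C) @ 0^' --> (0 : C)^'.
  move=> A [e e0 eA]; have := real_complex_continuous.
  move=> /(_ R 0 (ball (0 : C) e)) [|d d0 dA].
    exact: (@nbhsx_ballx _ C).
  exists d => // h dh h0; apply: eA; first exact: dA.
  by apply: contra h0 => /eqP[->].
have lim : (fun h : R^o => h^-1 *: (L (F (h *: (1 : R^o) + t)%:C) - L (F t%:C)) : R^o)
    @ 0^' --> (L ('D_1 F (t%:C)) : R^o).
  rewrite (_ : (fun h : R^o => _) = L \o
    (fun h : C => h^-1 *: (F (h *: (1 : C) + t%:C) - F t%:C)) \o
    (fun h : R^o => h%:C)).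
    by apply: continuous_cvg; [exact: Lc|exact: cvg_comp real0 dF].
  apply/funext => h /=; rewrite -LB.
  have -> : (h *: (1 : R^o) + t)%:C = h%:C *: (1 : C) + t%:C :> C.
    by rewrite /GRing.scale /= !mulr1 rmorphD.
  by rewrite -[LHS]/(h^-1 * _) -LZ fmorphV.
by apply: DeriveDef; [apply/cvg_ex; eexists; exact: lim|exact: cvg_lim lim].
Qed.

(** [F] is a primitive in the parameter of the segment, not in the endpoint. The real and imaginary
    parts of [segment_integral] are treated alike by [key]. *)
Lemma segment_integral_antiderivative F (h : C -> C) z :
  (forall t, 0 <= t <= 1 -> is_derive (t%:C : C) (1 : C) F (h (t%:C * z))) ->
  (forall t, 0 <= t <= 1 -> {for (t%:C * z), continuous h}) ->
  segment_integral h z = z * (F 1 - F 0).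
Proof.
move=> dF hc.
have key (L : C -> R) : continuous (L : C -> R^o) ->
    {morph L : z w / z - w} -> (forall (x : R) z, L (x%:C * z) = x * L z) ->
    (\int[lebesgue_measure]_(t in `[0, 1]) L (h (t%:C * z)))%R = L (F 1) - L (F 0).
  move=> Lc LB LZ; rewrite /Rintegral.
  have dL t t01 := is_derive_real_linear Lc LB LZ (dF t t01).
  have dLc t : 0 <= t <= 1 -> {for t, continuous (fun s : R^o => L (F s%:C) : R^o)}.
    by move=> /dL[? _]; exact/differentiable_continuous/derivable1_diffP.
  rewrite (@continuous_FTC2 _ _ (fun s : R => L (F s%:C)))//.
  - apply: continuous_in_subspaceT => t; rewrite inE/= in_itv/= => t01.
    apply: (@continuous_comp R^o C R^o (fun t => t%:C * z) (fun w => L (h w)) t).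
      apply: (@continuous_comp R^o C C (fun t => t%:C) (fun w => w * z) t).
        exact: real_complex_continuous.
      exact: (@cvgMr_tmp R[i] C (nbhs (t%:C : C)) _ id (t%:C) z cvg_id).
    by apply: continuous_comp; [exact: (hc t t01)|exact: Lc].
  - split; first by move=> t; rewrite in_itv/= => /andP[t0 t1];
        have [] := dL t; rewrite ?(ltW t0) ?(ltW t1).
      by apply: cvg_at_right_filter; apply: dLc; rewrite lexx ler01.
    by apply: cvg_at_left_filter; apply: dLc; rewrite lexx ler01.
  - move=> t; rewrite in_itv/= => /andP[t0 t1]; rewrite derive1E.
    by have [|_ ->] := dL t; rewrite ?(ltW t0) ?(ltW t1).
rewrite /segment_integral (key _ Re_continuous); first last.
- by move=> x [a b] /=; rewrite mul0r subr0.
- by move=> [? ?] [? ?].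
rewrite (key _ Im_continuous); first last.
- by move=> x [a b] /=; rewrite mul0r addr0.
- by move=> [? ?] [? ?].
congr (_ * _); apply/eqP; rewrite eq_complex /=.
by case: (F 1) => ? ?; case: (F 0) => ? ? /=; rewrite !eqxx.
Qed.

End complex_calculus.

(** * The peak functions and their images under the Cesàro operator *)

Section peak.
Variable R : realType.
Local Notation C := (R[i]^o).
Implicit Types (z : C) (d : R) (k : nat).

(* (1 - z) G'(z) for G(z) = (1 + d - z)^-k, extended by 0 outside the disc. *)
Definition peak d k : C -> C := fun z =>
  if normc z < 1 then k%:R * (1 - z) * ((1 + d)%:C - z)^-1 ^+ k.+1 else 0.

(** The real part of [z] is below 1, so moving the pole from 1 to [1 + d] moves it away from [z]. *)
Lemma normc_1B_le_peak_den d z : 0 < d -> normc z < 1 ->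
  normc (1 - z) <= normc ((1 + d)%:C - z).
Proof.
case: z => x y d0 xy1 /=; have := le_lt_trans (normr_Re_le_normc _) xy1.
rewrite ltr_norml => /andP[_]; rewrite [complex.Re _]/= => x1.
by rewrite ler_wsqrtr// lerD2r// ler_pXn2r ?nnegrE//=; lra.
Qed.

Lemma peak_den_ge d z : 0 < d -> normc z < 1 -> d <= normc ((1 + d)%:C - z).
Proof.
case: z => x y d0 xy1; apply: le_trans (normr_Re_le_normc _); rewrite /=.
have := le_lt_trans (normr_Re_le_normc _) xy1.
by rewrite ltr_norml/= => /andP[_ x1]; rewrite ger0_norm; lra.
Qed.

Lemma peak_den_neq0 d z : 0 < d -> normc z < 1 -> (1 + d)%:C - z != 0.
Proof.
move=> d0 z1; apply/eqP => u0; have := peak_den_ge d0 z1.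
by rewrite u0 normc0 leNgt d0.
Qed.

Lemma derivable_peak_pole d z : 0 < d -> normc z < 1 ->
  derivable (fun w : C => ((1 + d)%:C - w)^-1 : C) z 1.
Proof. by move=> d0 z1; apply: derivableV => //; exact: peak_den_neq0. Qed.

Lemma holomorphic_peak d k : 0 < d -> holomorphic (peak d k).
Proof.
move=> d0 z z1.
apply: (@near_eq_derivable _ C C
  ((fun w : C => k%:R * (1 - w) : C) * (fun w : C => ((1 + d)%:C - w)^-1 : C) ^+ k.+1)).
  apply: filterS (@open_nbhs_nbhs C z (@disc R) _) => [w w1|].
    by rewrite /peak w1 exprfctE.
  by split => //; exact: open_disc.
apply: derivableM; first by apply: derivableZ.
by apply: derivableX; exact: derivable_peak_pole.
Qed.

(** Division by [1 - zeta] cancels the factor [1 - z] of [peak] and leaves the exact derivative of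
    [G]. The primitive [P] is [s] mapped to [G (s * z) / z]. *)
Lemma cesaro_peak d k z : 0 < d -> normc z < 1 -> z != 0 ->
  cesaro_op (peak d k) z =
  z^-1 * (((1 + d)%:C - z)^-1 ^+ k - (1 + d)%:C^-1 ^+ k).
Proof.
move=> d0 z1 z0; rewrite /cesaro_op z1/= (negbTE z0).
have tz1 (t : R) : 0 <= t <= 1 -> normc (t%:C * z) < 1.
  move=> /andP[t0 t1]; rewrite normcM normc_real ger0_norm//.
  by rewrite (le_lt_trans _ z1)// ler_piMl// normc_ge0.
have den1 (w : C) : normc w < 1 -> 1 - w != 0.
  move=> w1; rewrite subr_eq0; apply: contraTN w1 => /eqP<-.
  by rewrite normc1 ltxx.
pose P := fun s : C => (((1 + d)%:C - s * z)^-1 ^+ k / z : C).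
have -> : segment_integral (fun zeta => peak d k zeta / (1 - zeta)) z =
    z * (P 1 - P 0).
  apply: (@segment_integral_antiderivative R P) => t t01; last first.
    have hc := holomorphic_continuous (holomorphic_peak (k := k) d0) (tz1 t t01).
    apply: (@cvgM R[i] C (nbhs (t%:C * z : C)) _ (peak d k)
      (fun w => (1 - w)^-1) _ _ hc).
    apply: cvgV; first by apply: den1; exact: tz1.
    by apply: cvgB; [exact: cvg_cst|exact: cvg_id].
  have t1 := tz1 t t01; have u0 := peak_den_neq0 d0 t1.
  rewrite /peak t1; set u := (1 + d)%:C - t%:C * z in u0 *.
  have du : is_derive (t%:C : C) (1 : C) (fun s : C => (1 + d)%:C - s * z : C) (- z).
    rewrite (_ : (fun s : C => _) = cst (1 + d)%:C - z *: (@id C)); last first.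
      by apply/funext => s; rewrite [s * z]mulrC.
    by apply: is_derive_eq; rewrite sub0r /GRing.scale/= mulr1.
  have dV : is_derive (t%:C : C) (1 : C) (fun s : C => ((1 + d)%:C - s * z)^-1 : C)
      (u ^- 2 * z).
    have [du1 du2] := du; apply: DeriveDef; first exact: derivableV.
    by rewrite deriveV// du2 /GRing.scale/= mulrNN.
  rewrite (_ : P = z^-1 *: ((fun s : C => ((1 + d)%:C - s * z)^-1 : C) ^+ k)); last first.
    by apply/funext => s; rewrite /P mulrC exprfctE.
  apply: is_derive_eq; rewrite /GRing.scale/= -/u.
  have w0 := den1 _ t1.
  (* The derivative of a power involves [k.-1], hence the separate case [k = 0], where both sides
     vanish. *)
  case: k {P} => [|k]; first by rewrite !mul0r mulr0.
  set w := 1 - t%:C * z in w0 *; clear du dV; clearbody u w.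
  rewrite [k.+1.-1]/= !exprVn !exprS expr0.
  have uk0 : u ^+ k != 0 by rewrite expf_neq0.
  by field; rewrite w0 u0 z0 uk0.
rewrite /P mul1r mul0r subr0 -mulrBl [z * _]mulrC mulfVK//.
Qed.

End peak.

(** * Upper bound for the weighted integral of a peak *)

Section peak_integral.
Variable R : realType.
Local Notation C := (R[i]^o).
Local Notation area := ((@lebesgue_measure R \x @lebesgue_measure R)%E).
Implicit Types (z : C) (d c p kappa : R) (k : nat).

Lemma cauchy_density_continuous d c : 0 < d ->
  continuous (fun x : R^o => (d ^+ 2 + (x - c) ^+ 2)^-1 : R^o).
Proof.
move=> d0 x; apply: cvgV.
  by rewrite gt_eqF// ltr_pwDl ?sqr_ge0// exprn_gt0.
apply: cvgD; first exact: cvg_cst.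
have hs : (fun y : R^o => y - c : R^o) @ x --> (x - c : R^o).
  by apply: cvgB; [exact: cvg_id|exact: cvg_cst].
rewrite expr2 (_ : (fun y : R^o => (y - c) ^+ 2) = fun y => (y - c) * (y - c)).
  exact: (cvgM hs hs).
by apply/funext => y; rewrite expr2.
Qed.

(** The primitive is the arctangent of [(x - c) / d] divided by [d], and the arctangent varies by
    less than [pi]. *)
Lemma integral_cauchy_density d c a b : 0 < d -> a < b ->
  (\int[lebesgue_measure]_(x in `[a, b]) ((d ^+ 2 + (x - c) ^+ 2)^-1)%:E <=
   (pi / d)%:E)%E.
Proof.
move=> d0 ab; have dn0 : d != 0 by rewrite gt_eqF.
pose F := d^-1 *: (@atan R \o (fun x : R => (x - c) / d)).
have dF (x : R) : is_derive (x : R^o) 1 (F : R^o -> R^o) ((d ^+ 2 + (x - c) ^+ 2)^-1).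
  have dlin : is_derive (x : R^o) 1 (fun x : R^o => (x - c) / d : R^o) d^-1.
    rewrite (_ : (fun x : R^o => _) = d^-1 *: ((@id R^o) - cst c)); last first.
      by apply/funext => y; rewrite /GRing.scale/= mulrC.
    by apply: is_derive_eq; rewrite subr0 /GRing.scale/= mulr1.
  have datan := @is_derive1_comp _ (@atan R) (fun x => (x - c) / d) x _ _
    (is_derive1_atan _) dlin.
  apply: is_derive_eq; rewrite /GRing.scale/=.
  field; rewrite dn0/= ?gt_eqF//; last by rewrite ltr_pwDl ?sqr_ge0// exprn_gt0.
have Fc : continuous (F : R^o -> R^o).
  by move=> x; apply/differentiable_continuous/derivable1_diffP; have [] := dF x.
rewrite (@continuous_FTC2 _ _ F)//.
- rewrite -EFinB lee_fin /F /GRing.scale/= -mulrBr mulrC ler_pM2r ?invr_gt0//.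
  have := atan_ltpi2 ((b - c) / d); have := atan_gtNpi2 ((a - c) / d); lra.
- by apply: continuous_subspaceT; exact: cauchy_density_continuous.
- split; first by move=> x _; have [] := dF x.
    by apply: cvg_at_right_filter; exact: Fc.
  by apply: cvg_at_left_filter; exact: Fc.
- by move=> x _; rewrite derive1E; have [_ ->] := dF x.
Qed.

Lemma measurable_cauchy_density d c : 0 < d ->
  measurable_fun setT (fun x : R => (d ^+ 2 + (x - c) ^+ 2)^-1).
Proof.
move=> d0; apply: continuous_measurable_fun; exact: cauchy_density_continuous.
Qed.

Lemma measurable_cauchy_density2 d c : 0 < d ->
  measurable_fun (@disc_plane R : set (measurableTypeR R * measurableTypeR R))
    (fun w => ((d ^+ 2 + (w.1 - c) ^+ 2)^-1 * (d ^+ 2 + w.2 ^+ 2)^-1)%:E).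
Proof.
move=> d0; apply/measurable_EFinP; apply: measurable_funTS; apply: measurable_funM.
  exact: (measurableT_comp (measurable_cauchy_density c d0)).
apply: (measurableT_comp (f := fun y : R => (d ^+ 2 + y ^+ 2)^-1)) => //.
by have := measurable_cauchy_density 0 d0; under eq_fun do rewrite subr0.
Qed.

(** The disc lies in the square of side 2 centred at 0, where Tonelli splits the integral into two
    one-variable factors. *)
Lemma integral_cauchy_density2 d c : 0 < d ->
  (\int[area]_(w in @disc_plane R)
     ((d ^+ 2 + (w.1 - c) ^+ 2)^-1 * (d ^+ 2 + w.2 ^+ 2)^-1)%:E <=
   ((pi / d) ^+ 2)%:E)%E.
Proof.
move=> d0.
pose g (e : R) : R -> \bar R :=
  (fun x => ((d ^+ 2 + (x - e) ^+ 2)^-1)%:E) \_ `[-1, 1].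
have g0 e x : (0 <= g e x)%E.
  by rewrite /g patchE; case: ifP => // _; rewrite lee_fin invr_ge0 addr_ge0// sqr_ge0.
have mg e : measurable_fun setT (g e).
  apply: (measurable_restrictT _ (measurable_itv _)).1; apply/measurable_EFinP.
  by apply: measurable_funTS; exact: measurable_cauchy_density.
have gint e : (\int[lebesgue_measure]_x g e x <= (pi / d)%:E)%E.
  rewrite -integral_mkcond; apply: integral_cauchy_density => //; lra.
have mgg : measurable_fun setT (fun w : R * R => g c w.1 * g 0%R w.2)%E.
  by apply: emeasurable_funM; apply: measurableT_comp.
apply: (@le_trans _ _ (\int[area]_w (g c w.1 * g 0%R w.2))%E).
  rewrite [leLHS]integral_mkcond; apply: ge0_le_integral => //.
  - move=> w _; rewrite patchE; case: ifP => // _.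
    by rewrite lee_fin mulr_ge0// invr_ge0 addr_ge0// sqr_ge0.
  - apply: (measurable_restrictT _ (@measurable_disc_plane R)).1.
    exact: measurable_cauchy_density2.
  - move=> w _; rewrite patchE; case: ifPn => [|_]; last by rewrite mule_ge0.
    move=> /set_mem wD.
    have w1 := le_lt_trans (normr_Re_le_normc _) wD.
    have w2 := le_lt_trans (normr_Im_le_normc _) wD.
    rewrite /g !patchE !mem_set/= ?subr0//.
      by move: w2; rewrite /= in_itv/= ltr_norml => /andP[/ltW-> /ltW->].
    by move: w1; rewrite /= in_itv/= ltr_norml => /andP[/ltW-> /ltW->].
rewrite fubini_tonelli1//; last by move=> w; rewrite mule_ge0.
rewrite /fubini_F.
rewrite (_ : (fun x => _) = fun x => (g c x * \int[lebesgue_measure]_y g 0%R y)%E).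
  rewrite ge0_integralZr//; [|exact: (mg c)|by apply: integral_ge0 => ? _].
  by rewrite expr2 EFinM lee_pmul// integral_ge0.
apply/funext => x.
by rewrite -ge0_integralZl//; exact: (mg 0).
Qed.

(** The factor [1 - z] absorbs one of the [k.+1] powers of the pole. *)
Lemma normc_peak_le d k z : 0 < d -> normc z < 1 ->
  normc (peak d k z) <= k%:R * normc ((1 + d)%:C - z) `^ (- k%:R).
Proof.
move=> d0 z1; have u0 : 0 < normc ((1 + d)%:C - z).
  exact: lt_le_trans (peak_den_ge d0 z1).
rewrite /peak z1 !normcM -mulrA; have -> : normc (k%:R : C) = k%:R.
  by rewrite -(rmorph_nat (@real_complex R)) normc_real normr_nat.
rewrite ler_wpM2l// normcX normcV exprVn powRN powR_mulrn ?(ltW u0)//.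
rewrite ler_pdivrMr ?exprn_gt0// exprS mulrCA mulVf ?mulr1 ?gt_eqF ?exprn_gt0//.
exact: normc_1B_le_peak_den.
Qed.

(** With [u] the distance from [z] to [1 + d], both [|1 - z|] and [1 - |z|] are at most [u], so the
    integrand is at most [k^p u^(kappa - k p)]. Four powers [u^-4] are set aside for the product of
    Cauchy densities, since [u^2] dominates each of the two denominators. The remaining exponent is
    nonpositive and [u >= d], so [u] may be replaced by [d] there. *)
Lemma peak_integrand_le p kappa d k z : 0 < p -> 0 <= kappa ->
  kappa + 4 <= k%:R * p -> 0 < d -> normc z < 1 ->
  normc (peak d k z) `^ p * (1 - normc z) `^ kappa <=
  k%:R `^ p * d `^ (kappa + 4 - k%:R * p) *
  ((d ^+ 2 + (complex.Re z - 1) ^+ 2)^-1 * (d ^+ 2 + complex.Im z ^+ 2)^-1).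
Proof.
move=> p0 kappa0 kp d0 z1; set u := normc ((1 + d)%:C - z).
have du : d <= u by exact: peak_den_ge.
have u0 : 0 < u by exact: lt_le_trans du.
have zu : 1 - normc z <= u.
  apply: le_trans (normc_1B_le_peak_den d0 z1).
  rewrite lerBlDr -(normc1 R); apply: le_trans (le_normcD _ _).
  by rewrite subrK.
apply: (@le_trans _ _ (k%:R `^ p * u `^ (- (k%:R * p)) * u `^ kappa)).
  apply: ler_pM; rewrite ?powR_ge0//.
    rewrite -mulNr powRrM -powRM ?powR_ge0//.
    by rewrite ge0_ler_powR ?nnegrE ?normc_ge0 ?mulr_ge0 ?powR_ge0 ?(ltW p0)// normc_peak_le.
  by rewrite ge0_ler_powR ?nnegrE ?subr_ge0 ?(ltW z1) ?(ltW u0).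
rewrite -!mulrA ler_wpM2l ?powR_ge0//.
have -> : u `^ (- (k%:R * p)) * u `^ kappa = u `^ (kappa + 4 - k%:R * p) * u ^- 4.
  rewrite -powR_mulrn ?(ltW u0)// -powRN -!powRD ?(gt_eqF u0) ?implybT//.
  by congr (_ `^ _); ring.
apply: ler_pM; rewrite ?powR_ge0 ?invr_ge0 ?exprn_ge0 ?(ltW u0)//.
  rewrite (_ : kappa + 4 - _ = - (k%:R * p - kappa - 4)); last by ring.
  rewrite !powRN lef_pV2 ?posrE ?powR_gt0//.
  by rewrite ge0_ler_powR ?nnegrE ?(ltW d0) ?(ltW u0)//; lra.
have d2 (x : R) : 0 < d ^+ 2 + x ^+ 2 by rewrite ltr_pwDl ?sqr_ge0// exprn_gt0.
rewrite -invfM lef_pV2 ?posrE ?mulr_gt0 ?exprn_gt0//.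
rewrite /u; case: z z1 {u du u0 zu} => x y /= z1.
have := le_lt_trans (normr_Re_le_normc (x +i* y)) z1.
rewrite ltr_norml => /andP[_]; rewrite [complex.Re _]/= => x1.
rewrite -[4%N]/(2 * 2)%N exprM sqr_sqrtr ?addr_ge0 ?sqr_ge0// expr2.
rewrite sub0r sqrrN; apply: ler_pM; rewrite ?(ltW (d2 _))//; nra.
Qed.

(** The two Cauchy densities contribute [(pi / d)^2], which lowers the exponent of [d] from
    [kappa + 4 - k p] by 2. *)
Lemma peak_integral p kappa d k : 0 < p -> 0 <= kappa ->
  kappa + 4 <= k%:R * p -> 0 < d ->
  (\int[area]_(w in @disc_plane R)
     (normc (peak d k (w.1 +i* w.2)) `^ p *
      (1 - normc (w.1 +i* w.2)) `^ kappa)%:E <=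
   (k%:R `^ p * pi ^+ 2 * d `^ (kappa + 2 - k%:R * p))%:E)%E.
Proof.
move=> p0 kappa0 kp d0.
have mD := @measurable_disc_plane R.
have a0 : 0 <= k%:R `^ p * d `^ (kappa + 4 - k%:R * p) by rewrite mulr_ge0 ?powR_ge0.
pose G w := ((d ^+ 2 + ((w : R * R).1 - 1) ^+ 2)^-1 * (d ^+ 2 + w.2 ^+ 2)^-1)%:E.
have G0 w : (0 <= G w)%E.
  by rewrite lee_fin mulr_ge0// invr_ge0 addr_ge0// sqr_ge0.
have mG : measurable_fun (@disc_plane R) G.
  exact: measurable_cauchy_density2.
apply: (@le_trans _ _ (\int[area]_(w in @disc_plane R)
   ((k%:R `^ p * d `^ (kappa + 4 - k%:R * p))%:E * G w))%E).
  apply: ge0_le_integral => //.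
  - by move=> w _; exact: bergman_integrand_ge0.
  - by apply: bergman_integrand_measurable; exact: holomorphic_peak.
  - exact: measurable_funeM.
  - by move=> w wD; rewrite -EFinM lee_fin; exact: peak_integrand_le.
rewrite ge0_integralZl//.
apply: (@le_trans _ _ ((k%:R `^ p * d `^ (kappa + 4 - k%:R * p))%:E *
  ((pi / d) ^+ 2)%:E)%E).
  by rewrite lee_wpmul2l ?lee_fin//; exact: integral_cauchy_density2.
rewrite -EFinM lee_fin expr_div_n -[leLHS]mulrA -[leRHS]mulrA ler_wpM2l ?powR_ge0//.
rewrite mulrCA ler_wpM2l ?sqr_ge0//.
rewrite -powR_mulrn ?(ltW d0)// -powRN -powRD ?(gt_eqF d0) ?implybT//.
rewrite le_eqVlt; apply/orP; left; apply/eqP; congr (_ `^ _); ring.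
Qed.

End peak_integral.

(** * Averages over a small square near 1 *)

Section window.
Variable R : realType.
Local Notation C := (R[i]^o).
Local Notation area := ((@lebesgue_measure R \x @lebesgue_measure R)%E).
Implicit Types (z : C) (f g : C -> C) (d p mu nu : R) (k : nat).

(** For [d < 1 / 3] this square stays at distance at least [d] from the circle, while its points are
    within [5 * d] of the pole [1 + d]. *)
Definition window d : set (measurableTypeR R * measurableTypeR R) :=
  `[1 - 3 * d, 1 - 2 * d] `*` `[0, d].

Definition window_integral d f : \bar R :=
  (\int[area]_(w in window d) (normc (f (w.1 +i* w.2)))%:E)%E.

(* The power of d makes the averages over the unit ball of A^p_nu bounded
   uniformly in d. *)
Definition window_average p nu d f : R :=
  d `^ ((nu + 2) / p - 2) * fine (window_integral d f).

Lemma measurable_window d : measurable (window d).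
Proof. by apply: measurableX; exact: measurable_itv. Qed.

Lemma area_window d : 0 < d -> area (window d) = (d ^+ 2)%:E.
Proof.
move=> d0; rewrite product_measure1E; [|exact: measurable_itv..].
have itv (a b : R) : a < b -> lebesgue_measure (`[a, b]%classic : set R) = (b - a)%:E.
  by move=> ab; rewrite lebesgue_measure_itv/= lte_fin ab.
rewrite [X in (X * _)%E]itv; last lra.
rewrite [X in (_ * X)%E]itv// -EFinM; congr EFin; ring.
Qed.

(** Both coordinates are nonnegative, so the modulus is at most their sum. *)
Lemma window_normc d w : 0 < d < 1 / 3 -> window d w -> normc (w.1 +i* w.2) <= 1 - d.
Proof.
case: w => x y /andP[d0 d3] [] /=; rewrite !in_itv/= => /andP[x1 x2] /andP[y1 y2].
rewrite -[leRHS]ger0_norm -?sqrtr_sqr; last by lra.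
rewrite ler_wsqrtr//; apply: (@le_trans _ _ ((x + y) ^+ 2)); first by nra.
by rewrite ler_pXn2r ?nnegrE//; lra.
Qed.

Lemma window_disc d : 0 < d < 1 / 3 -> window d `<=` @disc_plane R.
Proof.
move=> d3 w /(window_normc d3); rewrite /disc_plane /disc /=; lra.
Qed.

Lemma measurable_window_fun d f : 0 < d < 1 / 3 -> holomorphic f ->
  measurable_fun (window d) (fun w => (normc (f (w.1 +i* w.2)))%:E).
Proof.
move=> d3 hf; apply: (measurable_funS _ (window_disc d3)).
  exact: measurable_disc_plane.
apply/measurable_EFinP; apply: measurable_plane => z; exact: holomorphic_continuous.
Qed.

Lemma window_integral_ge0 d f : (0 <= window_integral d f)%E.
Proof. by apply: integral_ge0 => w _; rewrite lee_fin normc_ge0. Qed.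

Lemma le_1D_powR p (t : R) : 1 <= p -> 0 <= t -> t <= 1 + t `^ p.
Proof.
move=> p1 t0; have [t1|t1] := leP t 1; first by rewrite ler_wpDr ?powR_ge0.
rewrite -[leLHS]powRr1//; apply: le_trans (ler_powR (ltW t1) p1) _; by rewrite lerDr.
Qed.

(* Hoelder's inequality on the window, replaced by the pointwise bound
   t <= s (1 + (t / s)^p) with s = d^(- (mu + 2) / p). *)
Lemma window_integral_le p mu d f : 1 < p -> 0 <= mu -> 0 < d < 1 / 3 ->
  holomorphic f ->
  (window_integral d f <= (d `^ (2 - (mu + 2) / p))%:E *
   (1 + \int[area]_(w in @disc_plane R)
     (normc (f (w.1 +i* w.2)) `^ p * (1 - normc (w.1 +i* w.2)) `^ mu)%:E))%E.
Proof.
move=> p1 mu0 d3 hf; have p0 := lt_trans ltr01 p1; have /andP[d0 _] := d3.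
set F := fun w : R * R => _; set s := d `^ (- ((mu + 2) / p)).
have s0 : 0 < s by exact: powR_gt0.
have F0 w : (0 <= F w)%E by exact: bergman_integrand_ge0.
have mF : measurable_fun (@disc_plane R) F by exact: bergman_integrand_measurable.
have mW := @measurable_window d; have WD := window_disc d3.
have mFW : measurable_fun (window d) F.
  by apply: measurable_funS WD mF; exact: measurable_disc_plane.
have d2F0 w : (0 <= (d ^+ 2)%:E * F w)%E by rewrite mule_ge0// lee_fin sqr_ge0.
have mG : measurable_fun (window d) (fun w => 1 + (d ^+ 2)%:E * F w)%E.
  by apply: emeasurable_funD => //; exact: measurable_funeM.
apply: (@le_trans _ _ (\int[area]_(w in window d)
    (s%:E * (1 + (d ^+ 2)%:E * F w)))%E).
  apply: ge0_le_integral => //.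
  - by move=> w _; rewrite lee_fin normc_ge0.
  - exact: measurable_window_fun.
  - exact: measurable_funeM.
  move=> w Ww.
  rewrite -[leRHS]/(s * (1 + d ^+ 2 * (normc (f (w.1 +i* w.2)) `^ p *
    (1 - normc (w.1 +i* w.2)) `^ mu)))%:E lee_fin.
  have := window_normc d3 Ww.
  set t := normc (f _); set r := normc _ => rd.
  have t0 : 0 <= t by exact: normc_ge0.
  rewrite -ler_pdivrMl// mulrC; apply: le_trans (le_1D_powR (ltW p1) _) _.
    by rewrite divr_ge0 ?(ltW s0)//.
  rewrite lerD2l powRM ?invr_ge0 ?(ltW s0)// mulrCA ler_wpM2l ?powR_ge0//.
  rewrite /s -powRN opprK -powRrM divfK ?gt_eqF//.
  (* Of [s^-p = d^(2 + mu)], the factor [d^mu] is at most the weight on the window; the factor [d^2]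
     equals the area, so that both summands integrate to the same order. *)
  rewrite [mu + 2]addrC powRD ?(gt_eqF d0) ?implybT// powR_mulrn ?(ltW d0)//.
  rewrite ler_wpM2l ?sqr_ge0// ge0_ler_powR ?nnegrE ?(ltW d0)//; lra.
rewrite (ge0_integralZl _ mW mG) ?lee_fin ?(ltW s0)//; last first.
  by move=> w _; rewrite adde_ge0.
rewrite ge0_integralD//; last exact: measurable_funeM.
rewrite integral_cst// mul1e [X in (_ * (X + _) <= _)%E](area_window d0).
rewrite ge0_integralZl//; last first.
  by rewrite lee_fin sqr_ge0.
have -> : d `^ (2 - (mu + 2) / p) = s * d ^+ 2.
  by rewrite addrC powRD ?(gt_eqF d0) ?implybT// powR_mulrn ?(ltW d0).
rewrite [(s * d ^+ 2)%:E]EFinM -muleA lee_pmul2l// ?lte_fin// -[X in (X + _ <= _)%E]mule1.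
rewrite -ge0_muleDr ?integral_ge0// lee_pmul2l ?lte_fin ?exprn_gt0//.
by rewrite leeD2l// ge0_subset_integral//; exact: measurable_disc_plane.
Qed.

Lemma window_integral_fin p mu d f : 1 < p -> 0 <= mu -> 0 < d < 1 / 3 ->
  bergman_set p mu f -> window_integral d f \is a fin_num.
Proof.
move=> p1 mu0 d3 [hf _ /bergman_integral_ltP fi].
rewrite ge0_fin_numE ?window_integral_ge0//.
apply: le_lt_trans (window_integral_le p1 mu0 d3 hf) _.
by rewrite lte_mul_pinfty ?lee_fin ?powR_ge0// lte_add_pinfty ?ltry.
Qed.

Lemma window_average_ge0 p nu d f : 0 <= window_average p nu d f.
Proof. by rewrite mulr_ge0 ?powR_ge0// fine_ge0// window_integral_ge0. Qed.

(** The constant [pi] undoes the normalisation of the area measure in [bergman_integral]. The bound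
    is uniform in [d] as soon as [mu <= nu]. *)
Lemma window_average_le p mu nu d f : 1 < p -> 0 <= mu -> 0 < d < 1 / 3 ->
  bergman_set p mu f -> bergman_norm p mu f <= 1 ->
  window_average p nu d f <= d `^ ((nu - mu) / p) * (1 + pi).
Proof.
move=> p1 mu0 d3 bf f1; have p0 := lt_trans ltr01 p1; have /andP[d0 _] := d3.
have [hf _ /bergman_integral_ltP fi] := bf.
have wfin := window_integral_fin p1 mu0 d3 bf.
have le1 := window_integral_le p1 mu0 d3 hf.
set I := (\int[_]_(w in _) _)%E in fi le1.
have I0 : (0 <= I)%E by apply: integral_ge0 => w _; exact: bergman_integrand_ge0.
have Ifin : I \is a fin_num by rewrite ge0_fin_numE.
have Ipi : fine I <= pi.
  move: f1; rewrite /bergman_norm /bergman_integral -/I fineM//= => f1.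
  have q0 : 0 <= pi^-1 * fine I by rewrite mulr_ge0 ?invr_ge0 ?pi_ge0 ?fine_ge0.
  have : (pi^-1 * fine I) `^ p^-1 `^ p <= 1 `^ p.
    by rewrite ge0_ler_powR ?nnegrE ?powR_ge0 ?(ltW p0).
  rewrite -powRrM mulVf ?gt_eqF// powRr1// powR1 mulrC.
  by rewrite ler_pdivrMr ?pi_gt0// mul1r.
apply: (@le_trans _ _ (d `^ ((nu + 2) / p - 2) * (d `^ (2 - (mu + 2) / p) * (1 + fine I)))).
  rewrite ler_wpM2l ?powR_ge0// -lee_fin fineK//; apply: le_trans le1 _.
  by rewrite EFinM EFinD fineK.
rewrite mulrA -powRD ?(gt_eqF d0) ?implybT//.
have -> : (nu + 2) / p - 2 + (2 - (mu + 2) / p) = (nu - mu) / p by ring.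
by rewrite ler_wpM2l ?powR_ge0// lerD2l.
Qed.

(** The finiteness hypotheses let the inequality between extended reals pass through [fine]. *)
Lemma window_averageD p nu d f g : 0 < d < 1 / 3 ->
  holomorphic f -> holomorphic g ->
  window_integral d f \is a fin_num -> window_integral d g \is a fin_num ->
  window_average p nu d (f + g) <= window_average p nu d f + window_average p nu d g.
Proof.
move=> d3 hf hg ff gf; rewrite /window_average -mulrDr ler_wpM2l ?powR_ge0//.
have hfg : holomorphic (f + g).
  by move=> z z1; apply: derivableD; [exact: hf|exact: hg].
have mf := measurable_window_fun d3 hf; have mg := measurable_window_fun d3 hg.
have le : (window_integral d (f + g)%R <= window_integral d f + window_integral d g)%E.
  rewrite /window_integral -ge0_integralD//; first last.
  - by move=> w _; rewrite lee_fin normc_ge0.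
  - by move=> w _; rewrite lee_fin normc_ge0.
  - exact: measurable_window.
  apply: ge0_le_integral => //.
  - exact: measurable_window.
  - by move=> w _; rewrite lee_fin normc_ge0.
  - exact: (measurable_window_fun d3 hfg).
  - exact: emeasurable_funD.
  - by move=> w _; rewrite -EFinD lee_fin le_normcD.
have fgf : window_integral d (f + g) \is a fin_num.
  rewrite ge0_fin_numE ?window_integral_ge0//.
  by apply: le_lt_trans le _; rewrite lte_add_pinfty// ltey_eq ?ff ?gf.
by rewrite -lee_fin EFinD !fineK.
Qed.

Lemma window_averageZ p nu d (a : R[i]) f : 0 < d < 1 / 3 ->
  holomorphic f -> window_integral d f \is a fin_num ->
  window_average p nu d (a *: f) = normc a * window_average p nu d f.
Proof.
move=> d3 hf ff; rewrite /window_average mulrCA; congr (_ * _).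
rewrite /window_integral.
under eq_integral do rewrite -[(a *: f) _]/(a * f _) normcM EFinM.
rewrite ge0_integralZl//.
- by rewrite fineM.
- exact: measurable_window.
- exact: measurable_window_fun.
- by move=> w _; rewrite lee_fin normc_ge0.
- by rewrite lee_fin normc_ge0.
Qed.

End window.

(** * Quantitative unboundedness of the Cesàro operator on the peaks *)

Section peak_window.
Variable R : realType.
Local Notation C := (R[i]^o).
Implicit Types (z : C) (f g : C -> C) (d p mu nu : R) (k : nat).

(** The weight is at most 1, so exponent 0 is enough. *)
Lemma peak_bergman p d k mu : 0 < p -> 4 <= k%:R * p -> 0 < d -> 0 <= mu ->
  bergman_set p mu (peak d k).
Proof.
move=> p0 kp d0 mu0; apply: (bergman_le mu0); split.
- exact: holomorphic_peak.
- by move=> z /negP z1; rewrite /peak (negbTE z1).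
- apply/bergman_integral_ltP; apply: le_lt_trans (ltry _).
  by apply: peak_integral => //; rewrite add0r.
Qed.

Lemma bergman_norm_peak_le p d k mu : 0 < p -> 0 <= mu ->
  mu + 4 <= k%:R * p -> 0 < d ->
  bergman_norm p mu (peak d k) <=
  (k%:R `^ p * pi) `^ p^-1 * d `^ ((mu + 2) / p - k%:R).
Proof.
move=> p0 mu0 kp d0; rewrite /bergman_norm.
have bp : bergman_set p mu (peak d k) by apply: peak_bergman => //; lra.
have -> : (mu + 2) / p - k%:R = (mu + 2 - k%:R * p) * p^-1.
  by rewrite mulrBl mulfK ?gt_eqF.
rewrite [X in _ * X]powRrM -powRM ?powR_ge0 ?mulr_ge0 ?powR_ge0 ?pi_ge0//.
rewrite ge0_ler_powR ?nnegrE ?invr_ge0 ?(ltW p0) ?mulr_ge0 ?powR_ge0 ?pi_ge0//.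
  rewrite fine_ge0// mule_ge0 ?lee_fin ?invr_ge0 ?pi_ge0//.
  by apply: integral_ge0 => w _; exact: bergman_integrand_ge0.
rewrite -lee_fin fineK ?bergman_integral_fin//.
apply: le_trans (_ : ((pi^-1)%:E * (k%:R `^ p * pi ^+ 2 * d `^ (mu + 2 - k%:R * p))%:E <= _)%E).
  by rewrite lee_pmul2l ?lte_fin ?invr_gt0 ?pi_gt0//; exact: peak_integral.
rewrite -EFinM lee_fin le_eqVlt; apply/orP; left; apply/eqP.
have pi0 : pi != 0 :> R by rewrite gt_eqF ?pi_gt0.
by rewrite expr2 -!mulrA mulrCA mulKf.
Qed.

(** On the window [G] has modulus at least [(5 * d)^-k >= 2], and the subtracted constant has
    modulus at most 1, so at least half of [(5 * d)^-k] survives. The function [g] stands for the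
    image [T f]: its analyticity comes from membership in the target space, not from a study of
    [cesaro_op]. *)
Lemma window_average_cesaro_peak_ge p nu d k g : 0 < d -> (5 * d) ^+ k <= 1 / 2 ->
  d < 1 / 3 -> holomorphic g ->
  (forall z, disc z -> g z = cesaro_op (peak d k) z) ->
  window_integral d g \is a fin_num ->
  d `^ ((nu + 2) / p) * (5 * d) ^- k / 2 <= window_average p nu d g.
Proof.
move=> d0 dk d3 hg gE gfin; have d03 : 0 < d < 1 / 3 by rewrite d0.
have d5 : 0 < 5 * d by rewrite mulr_gt0.
have L0 : 0 < (5 * d) ^+ k by rewrite exprn_gt0.
have L2 : 2 <= (5 * d) ^- k.
  by rewrite -[2]invrK lef_pV2 ?posrE//; lra.
have lb : (((5 * d) ^- k / 2 * d ^+ 2)%:E <= window_integral d g)%E.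
  rewrite EFinM -area_window// -integral_cst; last exact: measurable_window.
  apply: ge0_le_integral.
  - exact: measurable_window.
  - by move=> w _; rewrite lee_fin divr_ge0 ?invr_ge0 ?ltW.
  - exact: measurable_cst.
  - exact: measurable_window_fun.
  case=> x y Wxy; have zd := window_disc d03 Wxy.
  have [] := Wxy; rewrite /= !in_itv/= => /andP[x1 x2] /andP[y1 y2].
  set z := x +i* y in zd *.
  have z1 : normc z < 1 by [].
  have z0 : z != 0.
    by rewrite eq_complex /= negb_and gt_eqF//; lra.
  rewrite lee_fin gE// cesaro_peak// normcM normcV.
  have nz : 0 < normc z.
    rewrite lt_neqAle normc_ge0 eq_sym andbT.
    by apply: contra z0 => /eqP/eq0_normc/eqP.
  rewrite ler_pdivlMl//; apply: (@le_trans _ _ ((5 * d) ^- k / 2)).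
    by rewrite ler_piMl ?ltW// divr_gt0// invr_gt0.
  have u0 := lt_le_trans d0 (peak_den_ge d0 z1).
  have big : (5 * d) ^- k <= normc (((1 + d)%:C - z)^-1 ^+ k).
    rewrite normcX normcV exprVn lef_pV2 ?posrE ?exprn_gt0//.
    rewrite lerXn2r ?nnegrE ?normc_ge0 ?mulr_ge0 ?(ltW d0)//=.
    have -> : 5 * d = `|5 * d| by rewrite ger0_norm// mulr_ge0 ?(ltW d0).
    by rewrite -sqrtr_sqr ler_wsqrtr//; nra.
  have small : normc ((1 + d)%:C^-1 ^+ k) <= 1.
    have d1 : 1 <= `|1 + d| by rewrite ger0_norm; lra.
    rewrite normcX normcV normc_real exprVn invf_le1 ?exprn_ege1//.
    by rewrite exprn_gt0// (lt_le_trans ltr01).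
  have := le_normcD (((1 + d)%:C - z)^-1 ^+ k - (1 + d)%:C^-1 ^+ k) ((1 + d)%:C^-1 ^+ k).
  rewrite subrK; lra.
apply: (@le_trans _ _ (d `^ ((nu + 2) / p - 2) * ((5 * d) ^- k / 2 * d ^+ 2))).
  rewrite [X in _ <= _ * X]mulrC [leRHS]mulrA -(powR_mulrn 2 (ltW d0)).
  by rewrite -powRD ?(gt_eqF d0) ?implybT// subrK mulrA.
by rewrite ler_wpM2l ?powR_ge0// -lee_fin fineK.
Qed.

(** The common engine for both spaces. The powers [d^((mu + 2) / p - k)] in the norm and
    [d^((nu + 2) / p - k)] in the average differ by [d^((mu - nu) / p)], which tends to 0 with
    [d]. *)
Lemma cesaro_unbounded p mu nu (e B : R) : 1 < p -> 0 <= nu -> nu < mu -> 0 < e ->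
  exists d f (c : R), [/\ 0 < d < 1 / 3, 0 <= c,
    forall kappa, 0 <= kappa -> bergman_set p kappa f,
    bergman_norm p mu (c%:C *: f) < e &
    forall g, holomorphic g -> (forall z, disc z -> g z = cesaro_op f z) ->
      window_integral d g \is a fin_num -> B <= c * window_average p nu d g].
Proof.
move=> p1 nu0 numu e0; have p0 := lt_trans ltr01 p1.
have mu0 : 0 < mu := le_lt_trans nu0 numu.
pose k := (Num.truncn ((mu + 4) / p)).+1.
have kp : mu + 4 <= k%:R * p.
  by rewrite -ler_pdivrMr// ltW// truncnS_gt.
pose M := (k%:R `^ p * pi) `^ p^-1 : R.
have M0 : 0 < M by rewrite powR_gt0// mulr_gt0 ?powR_gt0 ?pi_gt0.
pose a := (mu - nu) / p.
have a0 : 0 < a by rewrite divr_gt0// subr_gt0.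
(* The second entry is what the final comparison requires; the first keeps [B'] positive whatever
   the sign of [B]. *)
pose B' := Num.max 1 (B * (4 * M * 5 ^+ k / e)).
have B'0 : 0 < B' by rewrite lt_max ltr01.
(* The bound [1 / 10] gives [(5 * d)^k <= 1 / 2], as [k] is positive; the other entry gives
   [d^a <= 1 / B']. *)
pose d := Num.min (1 / 10) (B' `^ (- a^-1)).
have d0 : 0 < d by rewrite lt_min powR_gt0// divr_gt0.
have d10 : d <= 1 / 10 by rewrite ge_min lexx.
have dB : d `^ a <= B'^-1.
  have -> : B'^-1 = (B' `^ (- a^-1)) `^ a.
    by rewrite -powRrM mulNr mulVf ?gt_eqF// powR_inv1 ?ltW.
  by rewrite ge0_ler_powR ?nnegrE ?(ltW a0) ?(ltW d0) ?powR_ge0// ge_min lexx orbT.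
(* Normalises the peak to norm at most [e / 2] in the space of exponent [mu]. *)
pose c := e / (2 * M) * d `^ (k%:R - (mu + 2) / p).
have c0 : 0 < c by rewrite mulr_gt0 ?powR_gt0// divr_gt0// mulr_gt0.
have bp kappa : 0 <= kappa -> bergman_set p kappa (peak d k).
  by move=> kappa0; apply: peak_bergman => //; lra.
exists d, (peak d k), c; split => //; [by rewrite d0; lra|exact: ltW| |].
  rewrite bergman_normZ//; last exact/bp/ltW.
  rewrite normc_real gtr0_norm//.
  apply: le_lt_trans (_ : c * (M * d `^ ((mu + 2) / p - k%:R)) < _).
    by rewrite ler_wpM2l ?(ltW c0)// bergman_norm_peak_le// ltW.
  rewrite /c -mulrA [X in _ * X]mulrCA -powRD ?(gt_eqF d0) ?implybT//.
  have -> : k%:R - (mu + 2) / p + ((mu + 2) / p - k%:R) = 0 by ring.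
  have -> : e / (2 * M) * (M * d `^ 0) = e / 2.
    by rewrite powRr0; field; rewrite gt_eqF.
  lra.
move=> g hg gE gfin.
have dk : (5 * d) ^+ k <= 1 / 2.
  rewrite exprS; apply: (@le_trans _ _ (5 * d)); last lra.
  by rewrite ler_piMr ?exprn_ile1 ?mulr_ge0 ?(ltW d0)//; lra.
have d3 : d < 1 / 3 by lra.
have := window_average_cesaro_peak_ge p nu d0 dk d3 hg gE gfin.
rewrite -(ler_pM2l c0); apply: le_trans.
have -> : c * (d `^ ((nu + 2) / p) * (5 * d) ^- k / 2) =
    e / (4 * M * 5 ^+ k) * (d `^ a)^-1.
  have -> : (d `^ a)^-1 = d `^ (k%:R - (mu + 2) / p) * d `^ ((nu + 2) / p) * d ^- k.
    rewrite -powR_mulrn ?(ltW d0)// -!powRN -!powRD ?(gt_eqF d0) ?implybT//.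
    by congr (_ `^ _); rewrite /a; ring.
  rewrite /c exprMn; field.
  by rewrite !gt_eqF ?exprn_gt0.
apply: (@le_trans _ _ (e / (4 * M * 5 ^+ k) * B')).
  rewrite mulrC -ler_pdivrMr ?divr_gt0 ?mulr_gt0 ?exprn_gt0//.
  by rewrite invf_div le_max lexx orbT.
rewrite ler_wpM2l ?divr_ge0 ?mulr_ge0 ?exprn_ge0 ?(ltW e0) ?(ltW M0)//.
by rewrite -[B']invrK lef_pV2 ?posrE ?invr_gt0 ?powR_gt0.
Qed.

End peak_window.

(** * Neighbourhoods of 0, bounds on compact sets, and the intersection space *)

Section topology.
Variable R : realType.
Local Notation C := (R[i]^o).
Implicit Types (p alpha mu nu d : R).

Lemma compact_locally_bounded (X : topologicalType) (K : set X) (q : X -> R) :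
  compact K -> (forall x : X, exists B, \forall y \near x, q y <= B) ->
  exists B, forall x, K x -> q x <= B.
Proof.
move=> /compact_near_coveringP cK qB.
(* Compactness as near-covering, the parameter being the bound tending to infinity. *)
have /(_ R (pinfty_nbhs R) (fun B x => q x <= B) _ _) := cK.
case=> [x Kx|M [_ MK]]; last by exists (M + 1) => x; apply: MK; rewrite ltrDl.
have [B qxB] := qB x.
exists ([set y | q y <= B], [set b | B < b]).
  by split => //=; exists B; split => //; exact: num_real.
by move=> [y b] [/= yB Bb]; exact: le_trans yB (ltW Bb).
Qed.

Lemma seminorm_le_near (V : lmodType R[i]) (I : Type) (N : I -> V -> R)
    (sN : forall i, is_seminorm (N i)) i (x : seminorm_topology sN) :
  \forall y \near x, N i y <= N i (x : V) + 1.
Proof.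
apply: filterS (@seminorm_nbhs _ _ _ _ sN i x 1 ltr01) => y /= yx.
have := (sN i).1 (y - x) (x : V); rewrite subrK; lra.
Qed.

Lemma bergman_norm_le p mu nu (f : C -> C) : 0 < p -> mu <= nu ->
  bergman_set p mu f -> bergman_norm p nu f <= bergman_norm p mu f.
Proof.
move=> p0 munu bf; have bnf := bergman_le munu bf; have [hf _ _] := bf.
have pi0 : 0 <= (pi : R)^-1 by rewrite invr_ge0 pi_ge0.
have I0 kappa : (0 <= bergman_integral p kappa f)%E.
  rewrite mule_ge0 ?lee_fin//.
  by apply: integral_ge0 => w _; exact: bergman_integrand_ge0.
rewrite /bergman_norm ge0_ler_powR ?nnegrE ?invr_ge0 ?fine_ge0 ?(ltW p0)//.
apply: fine_le; [exact: bergman_integral_fin..|].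
rewrite /bergman_integral lee_wpmul2l ?lee_fin//; apply: ge0_le_integral => //.
- exact: measurable_disc_plane.
- by move=> w _; exact: bergman_integrand_ge0.
- exact: bergman_integrand_measurable.
- exact: bergman_integrand_measurable.
move=> w; rewrite /disc /= => wD; rewrite lee_fin ler_wpM2l ?powR_ge0//.
by rewrite ger_powR// subr_gt0 wD/= gerBl; exact: sqrtr_ge0.
Qed.

(** One norm suffices because the defining norms increase with [n]. *)
Lemma bergman_plus_nbhs0 p alpha (hp : 1 < p) (U : set (bergman_plus hp alpha)) :
  nbhs (0 : bergman_plus hp alpha) U -> exists n (e : R), 0 < e /\
    forall f : bergman_plus hp alpha, bergman_norm p (alpha + n.+1%:R^-1) f < e -> U f.
Proof.
pose A := bergman_plus hp alpha.
(* Using all norms of index up to [n] makes these sets a filter base; monotonicity of the norms is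
   needed only to conclude. *)
pose bal (ne : nat * R) : set A :=
  [set f : A | forall i, (i <= ne.1)%N -> bergman_norm p (alpha + i.+1%:R^-1) f < ne.2].
pose G := filter_from [set ne : nat * R | 0 < ne.2] bal.
have FG : Filter G.
  apply: filter_from_filter; first by exists (0%N, 1) => /=.
  move=> [n e] [m e'] /= e0 e'0; exists (maxn n m, Num.min e e') => /=.
    by rewrite lt_min e0.
  move=> f fb; split => i /= im.
    by have := fb i; rewrite /= leq_max im lt_min => /(_ isT)/andP[].
  by have := fb i; rewrite /= leq_max im orbT lt_min => /(_ isT)/andP[].
have G0 : G --> (0 : A).
  apply: (seminorm_cvg (sN := @bergman_plus_seminorm R p hp alpha)) => i e e0.
  by exists (i, e) => // f /= /(_ i (leqnn i)); rewrite subr0.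
move=> /G0 [[n e] /= e0 bU]; exists n, e; split => // f fe; apply: bU => i /= ni.
apply: le_lt_trans fe; apply: bergman_norm_le.
- exact: lt_trans ltr01 hp.
- by rewrite lerD2l lef_pV2 ?posrE// ler_nat.
- by have /set_mem := bergman_plusP f; apply; rewrite ltrDl invr_gt0.
Qed.

Lemma bergman_nbhs0 p mu (hp : 1 < p) (U : set (bergman hp mu)) :
  nbhs (0 : bergman hp mu) U -> exists2 e : R, 0 < e &
    forall f : bergman hp mu, bergman_norm p mu f < e -> U f.
Proof.
pose A := bergman hp mu.
pose bal (e : R) : set A := [set f : A | bergman_norm p mu f < e].
pose G := filter_from [set e : R | 0 < e] bal.
have FG : Filter G.
  apply: filter_from_filter; first by exists 1 => /=.
  move=> e e' /= e0 e'0; exists (Num.min e e') => /=; first by rewrite lt_min e0.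
  by move=> f; rewrite /bal /= lt_min => /andP[].
have G0 : G --> (0 : A).
  apply: (seminorm_cvg (sN := @bergman_seminorm R p hp mu)) => i e e0.
  by exists e => [//|f fe]; rewrite /= subr0.
by move=> /G0 [e /= e0 bU]; exists e.
Qed.

(** Homogeneous form of [window_average_le]. Scaling by a positive upper bound [e], not by the norm
    itself, avoids the case of norm 0. *)
Lemma window_average_le_norm p mu nu d (f : C -> C) (e : R) : 1 < p -> 0 <= mu ->
  0 < d < 1 / 3 -> bergman_set p mu f -> 0 < e -> bergman_norm p mu f <= e ->
  window_average p nu d f <= e * (d `^ ((nu - mu) / p) * (1 + pi)).
Proof.
move=> p1 mu0 d3 bf e0 fe; have p0 := lt_trans ltr01 p1; have [hf _ _] := bf.
have wfin := window_integral_fin p1 mu0 d3 bf.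
have := @window_average_le _ p mu nu d ((e^-1)%:C *: f) p1 mu0 d3 (bergman_setZ _ bf).
rewrite bergman_normZ// window_averageZ// normc_real gtr0_norm ?invr_gt0//.
by rewrite ler_pdivrMl// mulr1 ler_pdivrMl//; apply.
Qed.

Lemma cesaro_plus_not_compact p alpha (hp : 1 < p) (ha : 0 < alpha)
    (T : {linear bergman_plus hp alpha -> bergman_plus hp alpha}) :
  (forall f, T f = cesaro_op f :> (C -> C)) -> ~ compact_operator T.
Proof.
move=> TE [U /bergman_plus_nbhs0[n [e [e0 ballU]]] [K TUK [cK _]]].
have p0 := lt_trans ltr01 hp.
(* The exponent [nu] is the next one in the defining sequence, so its norm is one of the generating
   seminorms and is bounded on [K]. *)
set mu := alpha + _ in ballU; pose nu := alpha + n.+2%:R^-1.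
have nu0 : 0 < nu by rewrite addr_gt0.
have numu : nu < mu by rewrite ltrD2l ltf_pV2 ?posrE// ltr_nat.
have memA kappa (g : bergman_plus hp alpha) : alpha < kappa -> bergman_set p kappa g.
  by have /set_mem := bergman_plusP g; apply.
have [B KB] : exists B, forall g : bergman_plus hp alpha, K g -> bergman_norm p nu g <= B.
  apply: (compact_locally_bounded cK) => g; exists (bergman_norm p nu g + 1).
  exact: (@seminorm_le_near _ _ _ (@bergman_plus_seminorm R p hp alpha) n.+1 g).
pose B' := Num.max 1 B.
have B'0 : 0 < B' by rewrite lt_max ltr01.
have [d [f [c [d3 c0 bf fe fB]]]] :=
  (* One more than the bound [B' * (1 + pi)] that [window_average_le_norm] gives, with equal
     exponents, for functions of norm at most [B']. *)
  cesaro_unbounded (B' * (1 + pi) + 1) hp (ltW nu0) numu e0.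
have fA : f \in bergman_plus_set p alpha.
  by apply: mem_set => kappa ak; apply: bf; exact: ltW (lt_trans ha ak).
pose g : bergman_plus hp alpha := BergmanPlus hp fA.
have KTg : K (T (c%:C *: g)) by apply: TUK; exists (c%:C *: g) => //; exact: ballU.
have bTg : bergman_set p nu (T g) by apply: memA; rewrite ltrDl invr_gt0.
have hTg : holomorphic (T g) by have [] := bTg.
have wfin := window_integral_fin hp (ltW nu0) d3 bTg.
have := fB (T g) hTg _ wfin; rewrite TE => /(_ (fun _ _ => erefl)).
have := @window_average_le_norm p nu nu d (T (c%:C *: g)) B' hp (ltW nu0) d3 _ B'0 _.
rewrite subrr mul0r powRr0 mul1r linearZ.
rewrite -[bergman_plus_fun _]/(c%:C *: (T g : C -> C)) window_averageZ//.
rewrite normc_real ger0_norm// -TE => /(_ (bergman_setZ _ bTg)) le1.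
have /le1 : bergman_norm p nu (c%:C *: (T g : C -> C)) <= B'.
  by rewrite le_max; have := KB _ KTg; rewrite linearZ => ->; rewrite orbT.
by move=> h1 /le_trans/(_ h1); rewrite gerDl ler10.
Qed.

End topology.

(** * A continuous seminorm on the inductive limit, built from averages at prescribed scales *)

Section minus_seminorm.
Variables (R : realType) (p alpha : R) (hp : 1 < p) (ha : 0 < alpha).
Variables (d : nat -> R).
Hypothesis d3 : forall n, 0 < d n < 1 / 3.
Local Notation C := (R[i]^o).
Local Notation A := (bergman_minus hp ha).

(* The exponents nu_n, increasing to alpha. *)
Definition step_exponent (n : nat) : R := alpha - alpha / n.+1%:R.

Lemma step_exponent_ge0 n : 0 <= step_exponent n.
Proof. by rewrite subr_ge0 ler_pdivrMr// ler_peMr ?ler1n// ltW. Qed.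

Lemma step_exponent_lt n : step_exponent n < alpha.
Proof. by rewrite gtrBl divr_gt0. Qed.

Lemma step_exponent_lt_homo m n : (m < n)%N -> step_exponent m < step_exponent n.
Proof. by move=> mn; rewrite ltrD2l ltrN2 ltr_pM2l// ltf_pV2 ?posrE// ltr_nat. Qed.

Lemma step_exponent_ge mu : mu < alpha -> exists m, forall n, (m <= n)%N -> mu <= step_exponent n.
Proof.
move=> mua; have am : 0 < alpha - mu by rewrite subr_gt0.
exists (Num.truncn (alpha / (alpha - mu))) => n mn.
rewrite /step_exponent lerBrDl -lerBrDr ler_pdivrMr// mulrC -ler_pdivrMr//.
by apply: ltW; rewrite -truncn_lt_nat// divr_ge0// ltW.
Qed.

(* If nu_n >= mu then d_n^((nu_n - mu) / p) <= 1, so only finitely many n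
   matter for the constant. *)
Lemma window_averages_le mu : 0 <= mu -> mu < alpha ->
  exists2 M, 0 < M & forall (f : C -> C) e, bergman_set p mu f -> 0 < e ->
    bergman_norm p mu f <= e ->
    forall n, window_average p (step_exponent n) (d n) f <= e * M.
Proof.
move=> mu0 /step_exponent_ge[m mP].
pose u n := d n `^ ((step_exponent n - mu) / p).
exists ((1 + \sum_(i < m) u i) * (1 + pi)).
  have := pi_gt0 R; have : 0 <= \sum_(i < m) u i by apply: sumr_ge0 => i _; exact: powR_ge0.
  by move=> u0 p0; rewrite mulr_gt0 ?ltr_pwDl ?(ltW p0).
move=> f e bf e0 fe n.
apply: le_trans (window_average_le_norm (step_exponent n) hp mu0 (d3 n) bf e0 fe) _.
have pi0 : 0 <= 1 + (pi : R) by rewrite addr_ge0// pi_ge0.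
rewrite ler_wpM2l ?(ltW e0)// ler_wpM2r// -/(u n).
have [nm|mn] := ltnP n m.
  rewrite (bigD1 (Ordinal nm))//= addrCA lerDl addr_ge0//.
  by apply: sumr_ge0 => i _; exact: powR_ge0.
apply: (@le_trans _ _ 1); last by rewrite lerDl; apply: sumr_ge0 => i _; exact: powR_ge0.
have /andP[d0 dn] := d3 n.
rewrite -[leRHS](powRr0 (d n)) ger_powR//; first by rewrite d0/=; lra.
by rewrite divr_ge0 ?subr_ge0 ?mP// (le_trans ler01)// ltW.
Qed.

Lemma bergman_minus_mem (f : A) : exists2 mu, 0 < mu < alpha & bergman_set p mu f.
Proof. exact: (set_mem (bergman_minusP f)). Qed.

Lemma holomorphic_bergman_minus (f : A) : holomorphic f.
Proof. by have [mu _ []] := bergman_minus_mem f. Qed.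

Lemma bergman_minus_window_fin (f : A) n : window_integral (d n) f \is a fin_num.
Proof.
have [mu /andP[mu0 _] bf] := bergman_minus_mem f.
exact: window_integral_fin hp (ltW mu0) (d3 n) bf.
Qed.

Definition window_sup (f : A) : R :=
  sup (range (fun n => window_average p (step_exponent n) (d n) f)).

(** Each [f] lies in a single step of the union, where [window_averages_le] bounds all averages at
    once; otherwise [sup] would take its default value 0. *)
Lemma window_sup_has_sup (f : A) :
  has_sup (range (fun n => window_average p (step_exponent n) (d n) f)).
Proof.
split; first by exists (window_average p (step_exponent 0) (d 0%N) f), 0%N.
have [mu /andP[mu0 mua] bf] := bergman_minus_mem f.
have [M M0 MP] := window_averages_le (ltW mu0) mua.
have e0 : 0 < bergman_norm p mu f + 1 by rewrite ltr_wpDl ?powR_ge0.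
exists ((bergman_norm p mu f + 1) * M) => _ [n _ <-]; apply: MP => //.
by rewrite lerDl.
Qed.

Lemma window_average_le_sup (f : A) n :
  window_average p (step_exponent n) (d n) f <= window_sup f.
Proof. by apply: (sup_upper_bound (window_sup_has_sup f)); exists n. Qed.

Lemma window_sup_le (f : A) (B : R) :
  (forall n, window_average p (step_exponent n) (d n) f <= B) -> window_sup f <= B.
Proof.
move=> fB; apply: ge_sup => [|_ [n _ <-]//].
by have [] := window_sup_has_sup f.
Qed.

(** The [unit] argument makes this a family with one index, as [seminorm_topology] expects. The
    reverse inequality for scalars follows from [supZ] applied to the inverse scalar. *)
Lemma window_sup_seminorm (_ : unit) : is_seminorm window_sup.
Proof.
have supZ a (f : A) : window_sup (a *: f) <= normc a * window_sup f.
  apply: window_sup_le => n.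
  rewrite -[bergman_minus_fun _]/(a *: (f : C -> C)) window_averageZ//.
  - by rewrite ler_wpM2l ?normc_ge0 ?window_average_le_sup.
  - exact: holomorphic_bergman_minus.
  - exact: bergman_minus_window_fin.
split=> [f g|a f].
  apply: window_sup_le => n.
  apply: le_trans (lerD (window_average_le_sup f n) (window_average_le_sup g n)).
  rewrite -[bergman_minus_fun _]/((f : C -> C) + (g : C -> C)).
  by apply: window_averageD => //;
    (exact: holomorphic_bergman_minus || exact: bergman_minus_window_fin).
apply/eqP; rewrite eq_le supZ/=; have [->|a0] := eqVneq a 0.
  rewrite scale0r normc0 mul0r; apply: le_trans (window_average_le_sup 0 0).
  exact: window_average_ge0.
rewrite -ler_pdivlMl ?(lt_neqAle, normc_ge0, andbT).
  by rewrite -normcV -[X in window_sup X <= _](scalerK a0).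
by rewrite eq_sym; apply: contra a0 => /eqP/eq0_normc/eqP.
Qed.

(** Places the topology of [window_sup] among those whose supremum is the inductive topology, which
    makes [window_sup] continuous there. It reduces to continuity on each step, given by
    [window_averages_le]. *)
Lemma window_sup_admissible :
  final_admissible (@bergman_incl R p alpha hp ha)
    (Topological.on (seminorm_topology window_sup_seminorm)).
Proof.
split.
  by split; [exact: seminorm_add|exact: seminorm_scale|exact: seminorm_convex].
move=> [mu /= muP] x.
apply: (@seminorm_cvg _ _ _ _ _ _ _
  (fmap_filter _ (nbhs_filter (x : bergman hp mu)))) => _ e e0.
have /andP[mu0 mua] := muP.
have [M M0 MP] := window_averages_le (ltW mu0) mua.
have eM : 0 < e / 2 / M by rewrite !divr_gt0.
have := @seminorm_nbhs _ _ _ _ (@bergman_seminorm R p hp mu) tt x _ eM.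
(* A supremum only inherits a weak inequality; halving [e] restores strictness. *)
apply: filterS => y /= /ltW yx; apply: (@le_lt_trans _ _ (e / 2)); last by lra.
apply: window_sup_le => n.
have -> : e / 2 = e / 2 / M * M by rewrite divfK// gt_eqF.
exact: (MP _ _ (set_mem (bergmanP (y - x : bergman hp mu))) eM yx n).
Qed.

Lemma window_sup_le_near (x : A) :
  \forall y \near x, window_sup y <= window_sup x + 1.
Proof.
apply: (final_lc_nbhs window_sup_admissible).
exact: (@seminorm_le_near _ _ _ _ window_sup_seminorm tt x).
Qed.

End minus_seminorm.

(** * Failure of compactness on the inductive limit *)

Section minus.
Variables (R : realType) (p alpha : R) (hp : 1 < p) (ha : 0 < alpha).
Local Notation C := (R[i]^o).
Local Notation A := (bergman_minus hp ha).

(** Continuity of the inclusion pulls [U] back to a neighbourhood of 0 in the Banach step. *)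
Lemma bergman_minus_nbhs0 (mu : R) (U : set A) : 0 < mu < alpha ->
  nbhs (0 : A) U -> exists2 e : R, 0 < e &
    forall f : A, bergman_set p mu f -> bergman_norm p mu f < e -> U f.
Proof.
move=> muP U0.
have [_ /(_ (exist _ mu muP)) icont] :=
  @final_lc_admissible _ _ _ _ (@bergman_incl R p alpha hp ha).
have i0 : bergman_incl (m := exist _ mu muP) ha (0 : bergman hp mu) = 0.
  exact: (@val_inj _ _ A).
have := icont 0 U; rewrite i0 => /(_ U0)/bergman_nbhs0[e e0 ballU].
exists e => // f bf fe.
have -> : f = bergman_incl (m := exist _ mu muP) ha (Bergman hp (mem_set bf)).
  exact: (@val_inj _ _ A).
exact: ballU.
Qed.

Lemma cesaro_minus_not_compact (T : {linear A -> A}) :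
  (forall f, T f = cesaro_op f :> (C -> C)) -> ~ compact_operator T.
Proof.
move=> TE [U U0 [K TUK [cK _]]].
have p0 := lt_trans ltr01 hp.
pose nu := step_exponent alpha.
(* Since [nu 0 = 0] is not an admissible exponent of the union, the domain norm uses [nu n.+1] and
   the average uses [nu n]. *)
have muP n : 0 < nu n.+1 < alpha.
  by rewrite step_exponent_lt// andbT;
  exact: le_lt_trans (step_exponent_ge0 ha 0) (step_exponent_lt_homo ha _).
(* The scale depends on the ball contained in [U], so scales and functions are chosen together,
   before the seminorm is formed. *)
have /choice[x xP] n : exists x : R * A,
    [/\ 0 < x.1 < 1 / 3, U x.2 & n%:R <= window_average p (nu n) x.1 (T x.2)].
  have [e e0 ballU] := bergman_minus_nbhs0 (muP n) U0.
  have nun : nu n < nu n.+1 by exact: step_exponent_lt_homo.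
  have [d [f [c [d3 c0 bf fe fB]]]] :=
    cesaro_unbounded n%:R hp (step_exponent_ge0 ha n) nun e0.
  have fA : f \in bergman_minus_set p alpha.
    apply: mem_set; exists (nu n.+1); first exact: muP.
    by apply: bf; exact: step_exponent_ge0.
  pose g : A := BergmanMinus hp ha fA.
  exists (d, c%:C *: g); split => //=.
    apply: ballU; last exact: fe.
    by apply: bergman_setZ; apply: bf; exact: step_exponent_ge0.
  have [kappa /andP[kappa0 _] bTg] := bergman_minus_mem (T g).
  have [hTg _ _] := bTg.
  have wfin := window_integral_fin hp (ltW kappa0) d3 bTg.
  have := fB (T g) hTg _ wfin; rewrite TE => /(_ (fun _ _ => erefl)).
  rewrite linearZ -[bergman_minus_fun (_ *: _)]/(c%:C *: (T g : C -> C)).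
  by rewrite window_averageZ// normc_real ger0_norm// TE.
have d3 n : 0 < (x n).1 < 1 / 3 by have [] := xP n.
(* The seminorm tuned to the chosen scales: it dominates the [n]-th average of the [n]-th image,
   which is at least [n]. *)
pose q := @window_sup R p alpha hp ha (fun n => (x n).1).
have [B KB] : exists B, forall g : A, K g -> q g <= B.
  apply: (compact_locally_bounded cK) => g; exists (q g + 1).
  exact: (window_sup_le_near d3).
have [_ Ux nle] := xP (Num.truncn B).+1.
have /KB : K (T (x (Num.truncn B).+1).2) by apply: TUK; exists (x (Num.truncn B).+1).2.
apply/negP; rewrite -ltNge; apply: lt_le_trans (truncnS_gt B) _.
exact: le_trans nle (window_average_le_sup d3 _ _).
Qed.

End minus.

Theorem proposition2p8 (R : realType) (p alpha : R)
    (hp : 1 < p) (ha : 0 < alpha) :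
  (forall T : {linear bergman_plus hp alpha -> bergman_plus hp alpha},
     (forall f, T f = cesaro_op f :> (R[i]^o -> R[i]^o)) ->
     ~ compact_operator T) /\
  (forall T : {linear bergman_minus hp ha -> bergman_minus hp ha},
     (forall f, T f = cesaro_op f :> (R[i]^o -> R[i]^o)) ->
     ~ compact_operator T).
Proof.
by split => T TE; [exact: cesaro_plus_not_compact|exact: cesaro_minus_not_compact].
Qed.
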